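(* Let $\mathcal{T}$ be a robust tangle of order $k$ in a connectivity system $(E,\lambda)$, and let $\mathcal{S}$ be a tree compatible set. If $T$ is an $\mathcal{S}$-maximal partial $(k,\mathcal{S})$-tree for $\mathcal{T}$, then every $(k,\mathcal{S})$-separation of $\lambda$ is $\mathcal{T}$-equivalent to some $(k,\mathcal{S})$-separation displayed by $T$.
   Context: A connectivity system is a pair $(E,\lambda)$ with $E$ finite and $\lambda$ an integer-valued function on subsets of $E$ that is symmetric ($\lambda(X)=\lambda(E-X)$) and submodular ($\lambda(X)+\lambda(Y)\ge\lambda(X\cup Y)+\lambda(X\cap Y)$). For a positive integer $k$, $X\subseteq E$ is $k$-separating if $\lambda(X)\le k$; a $k$-separation is an unordered partition $(X,E-X)$ with $\lambda(X)\le k$ (parts may be empty). A tangle of order $k$ is a collection $\mathcal T$ of subsets of $E$ with (T1) $\lambda(A)<k$ for all $A\in\mathcal T$; (T2) if $\lambda(A)\le k-1$ then $A\in\mathcal T$ or $E-A\in\mathcal T$; (T3) $A\cup B\cup C\neq E$ for $A,B,C\in\mathcal T$; (T4) $E-\{e\}\notin\mathcal T$ for all $e\in E$. A robust tangle of order $k$ satisfies (T1),(T2),(T4) and (RT3): $A_1\cup\cdots\cup A_8\ne E$ for all $A_1,\dots,A_8\in\mathcal T$. A set is $\mathcal T$-weak if contained in a member of $\mathcal T$, otherwise $\mathcal T$-strong; a partition (or $k$-separation) is $\mathcal T$-strong if all its parts are. A $\mathcal T$-strong $k$-separating set $X$ is fully closed if $X\cup Y$ is not $k$-separating for every nonempty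 $\mathcal T$-weak $Y\subseteq E-X$; for a $\mathcal T$-strong $k$-separating $X$, $\mathrm{fcl}_{\mathcal T}(X)$ is the intersection of all fully closed $k$-separating sets containing $X$. $\mathcal T$-strong $k$-separations $(X,Y),(X',Y')$ are $\mathcal T$-equivalent if $\{\mathrm{fcl}_{\mathcal T}(X),\mathrm{fcl}_{\mathcal T}(Y)\}=\{\mathrm{fcl}_{\mathcal T}(X'),\mathrm{fcl}_{\mathcal T}(Y')\}$. A $k$-separating $X$ is $\mathcal T$-sequential if $E-X$ is $\mathcal T$-strong and $\mathrm{fcl}_{\mathcal T}(E-X)=E$; a $k$-separation is non-sequential if neither part is $\mathcal T$-sequential. Let $\mathcal S$ be a set of non-$\mathcal T$-sequential $k$-separating sets with $\mathcal T$-strong complements; a $(k,\mathcal S)$-separation is a $k$-separation $(X,E-X)$ with $X,E-X\in\mathcal S$. $\mathcal S$ is tree compatible if (S1) any $\mathcal T$-strong $k$-separation $\mathcal T$-equivalent to a $(k,\mathcal S)$-separation is a $(k,\mathcal S)$-separation, and (S2) if $X\in\mathcal S$ and $(Y,E-Y)$ is a $\mathcal T$-strong $k$-separation with $X\subseteq Y$ then $Y\in\mathcal S$. A $k$-flower in $\mathcal T$ is a $\mathcal T$-strong partition $(P_1,\dots,P_n)$ of $E$ with $P_i$ and $P_i\cup P_{i+1}$ $k$-separating for all $i$ (indices mod $n$); it displays the $k$-separations $(X,E-X)$ with $X$ a union of petals. It is a $k$-anemone if every nonempty union of petals is $k$-separating, and a $k$-daisy if exactly the unions of cyclically consecutive petals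 are. For flowers, $\Phi_1\preccurlyeq_{\mathcal S}\Phi_2$ if every $(k,\mathcal S)$-separation displayed by $\Phi_1$ is $\mathcal T$-equivalent to one displayed by $\Phi_2$; equivalence means both directions. The $\mathcal S$-order of $\Phi$ is the minimum number of petals of a flower equivalent to $\Phi$. For $n\ge2$ a petal $P_i$ is $\mathcal T$-loose if $P_i\subseteq\mathrm{fcl}_{\mathcal T}(P_j)$ for a petal $P_j\ne P_i$ that is consecutive to $P_i$ in the cyclic order (for a $k$-anemone, any other petal). Let $\pi$ be a partition of $E$ (members may be empty). A $\pi$-labelled tree is a tree $T$ in which each member of $\pi$ (a bag) labels a distinct vertex (bag vertex); other vertices carry no bag. An edge $e$ displays the partition of $E$ into the unions of bags of the two components of $T\setminus e$; a non-bag vertex $v$ displays the partition into unions of bags of the components of $T-v$ (cyclically ordered by a cyclic order on the edges at $v$, if given). A partial $(k,\mathcal S)$-tree for $\mathcal T$ is a $\pi$-labelled tree with: (P1) each edge displays a $\mathcal T$-strong $k$-separation, which is a $(k,\mathcal S)$-separation if the edge joins two bag vertices; (P2) each non-bag vertex is labelled $D$ or $A$, and $D$-vertices carry a cyclic ordering of their incident edges; (P3) an $A$-vertex displays a $k$-anemone of $\mathcal S$-order at least $3$ with no $\mathcal T$-loose petals; (P4) a $D$-vertex displays, in its cyclic order, a $k$-daisy of $\mathcal S$-order at least 3 with no $\mathcal T$-loose petals; (P5) every $(k,\mathcal S)$-separation conforms with $T$. A $k$-separation is displayed by $T$ if it is displayed by an edge, or is displayed by the flower displayed by a non-bag vertex.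 A $\mathcal T$-strong $k$-separation conforms with $T$ if it is $\mathcal T$-equivalent to one displayed by $T$ or to one $(X',Y')$ with $X'$ or $Y'$ contained in a bag. For partial $(k,\mathcal S)$-trees, $T\preccurlyeq_{\mathcal S}T'$ if each $(k,\mathcal S)$-separation displayed by $T$ is $\mathcal T$-equivalent to one displayed by $T'$; $T$ is $\mathcal S$-maximal if it is maximal in this quasi-order. *)

(* Defs.v *)
From HB Require Import structures.
From mathcomp Require Import all_boot all_order all_algebra.
Import Order.TTheory GRing.Theory Num.Theory.

Record ptree (E : finType) := PTree {
  pt_V : finType;
  pt_adj : rel pt_V;
  pt_isbag : pred pt_V;
  pt_bag : pt_V -> {set E};
  pt_isD : pred pt_V;                (* non-bag vertex labelled D (true) or A (false) *)
  pt_cord : pt_V -> seq pt_V         (* cyclic order of the neighbours of a D-vertex *)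
}.
Arguments pt_V {E}. Arguments pt_adj {E}. Arguments pt_isbag {E}.
Arguments pt_bag {E}. Arguments pt_isD {E}. Arguments pt_cord {E}.

Set Implicit Arguments. Unset Strict Implicit. Unset Printing Implicit Defensive.

Section Defs.
Variable E : finType.

Definition connectivity_system (lam : {set E} -> int) : Prop :=
  (forall X, lam X = lam (~: X)) /\
  (forall X Y, (lam (X :|: Y) + lam (X :&: Y) <= lam X + lam Y)%R).

Variable lam : {set E} -> int.
Variable k : nat.
Variable Tg : {set {set E}}.

Definition ksep (X : {set E}) : bool := (lam X <= k%:Z)%R.

Definition robust_tangle : Prop :=
  (forall A, A \in Tg -> (lam A < k%:Z)%R) /\
  (forall A, (lam A <= k%:Z - 1)%R -> A \in Tg \/ ~: A \in Tg) /\
  (forall A : 'I_8 -> {set E}, (forall i, A i \in Tg) -> \bigcup_(i < 8) A i != setT) /\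
  (forall e : E, ~: [set e] \notin Tg).

Definition weak (X : {set E}) : bool := [exists A in Tg, X \subset A].
Definition strong (X : {set E}) : bool := ~~ weak X.

Definition fully_closed (X : {set E}) : bool :=
  [&& strong X, ksep X &
    [forall Y : {set E},
       [&& Y != set0, weak Y & Y \subset ~: X] ==> ~~ ksep (X :|: Y)]].

Definition fcl (X : {set E}) : {set E} :=
  \bigcap_(Z | fully_closed Z && (X \subset Z)) Z.

Definition strong_ksep (X : {set E}) : bool :=
  [&& strong X, strong (~: X) & ksep X].

Definition tequiv (X Y : {set E}) : bool :=
  [&& strong_ksep X, strong_ksep Y &
    ((fcl X == fcl Y) && (fcl (~: X) == fcl (~: Y))) ||
    ((fcl X == fcl (~: Y)) && (fcl (~: X) == fcl Y))].

Definition tsequential (X : {set E}) : bool :=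
  [&& ksep X, strong (~: X) & fcl (~: X) == setT].

Variable S : {set {set E}}.

Definition kS_sep (X : {set E}) : bool := [&& ksep X, X \in S & ~: X \in S].

Definition tree_compatible : Prop :=
  (forall X, X \in S -> [&& ksep X, ~~ tsequential X & strong (~: X)]) /\
  (forall X Y, kS_sep X -> strong_ksep Y -> tequiv X Y -> kS_sep Y) /\
  (forall X Y, X \in S -> strong_ksep Y -> X \subset Y -> Y \in S).

Definition petal (P : seq {set E}) (i : nat) : {set E} := nth set0 P i.

Definition upet (P : seq {set E}) (I : {set 'I_(size P)}) : {set E} :=
  \bigcup_(i in I) petal P i.

Definition flower (P : seq {set E}) : Prop :=
  0 < size P /\
  (forall i j, i < size P -> j < size P -> i != j ->
     [disjoint petal P i & petal P j]) /\
  \bigcup_(i < size P) petal P i = setT /\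
  (forall i, i < size P ->
     [&& strong (petal P i), ksep (petal P i) &
         ksep (petal P i :|: petal P ((i + 1) %% size P))]).

Definition anemone (P : seq {set E}) : Prop :=
  flower P /\ forall I : {set 'I_(size P)}, I != set0 -> ksep (@upet P I).

Definition cyc_interval (n : nat) (I : {set 'I_n}) : Prop :=
  exists a b : nat, b < n /\
    forall i : 'I_n, i \in I <-> exists2 t, t <= b & val i = (a + t) %% n.

Definition daisy (P : seq {set E}) : Prop :=
  flower P /\ forall I : {set 'I_(size P)}, I != set0 ->
    (ksep (@upet P I) <-> @cyc_interval (size P) I).

Definition flower_displays (P : seq {set E}) (X : {set E}) : Prop :=
  ksep X /\ exists I : {set 'I_(size P)}, X = @upet P I.

Definition flower_le (P Q : seq {set E}) : Prop :=
  forall X, kS_sep X -> flower_displays P X ->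
    exists2 Y, kS_sep Y /\ flower_displays Q Y & tequiv X Y.

Definition flower_equiv (P Q : seq {set E}) : Prop := flower_le P Q /\ flower_le Q P.

Definition has_Sorder (P : seq {set E}) (m : nat) : Prop :=
  (exists Q, flower Q /\ flower_equiv P Q /\ size Q = m) /\
  (forall Q, flower Q -> flower_equiv P Q -> m <= size Q).

Definition Sorder_ge3 (P : seq {set E}) : Prop :=
  exists m, has_Sorder P m /\ 3 <= m.

Definition no_loose_daisy (P : seq {set E}) : Prop :=
  2 <= size P ->
  forall i j, i < size P -> j < size P -> j != i ->
    (j == (i + 1) %% size P) || (i == (j + 1) %% size P) ->
    ~~ (petal P i \subset fcl (petal P j)).

Definition no_loose_anemone (P : seq {set E}) : Prop :=
  2 <= size P ->
  forall i j, i < size P -> j < size P -> j != i ->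
    ~~ (petal P i \subset fcl (petal P j)).

Section Tree.
Variable T : ptree E.
Local Notation V := (pt_V T).
Local Notation adj := (pt_adj T).
Local Notation isbag := (pt_isbag T).

Definition bagset (w : V) : {set E} := if isbag w then pt_bag T w else set0.

Definition cut_rel (u w : V) : rel V :=
  [rel x y | adj x y && ~~ (((x == u) && (y == w)) || ((x == w) && (y == u)))].
Definition avoid_rel (v : V) : rel V :=
  [rel x y | [&& adj x y, x != v & y != v]].

Definition is_tree : Prop :=
  0 < #|V| /\ symmetric adj /\ irreflexive adj /\
  (forall x y, connect adj x y) /\
  (forall u w, adj u w -> ~~ connect (cut_rel u w) u w).

Definition pi_labelled : Prop :=
  is_tree /\
  (forall u w, isbag u -> isbag w -> u != w -> [disjoint pt_bag T u & pt_bag T w]) /\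
  \bigcup_(w | isbag w) pt_bag T w = setT.

Definition eside (u w : V) : {set E} :=
  \bigcup_(x | connect (cut_rel u w) u x) bagset x.

Definition vpetal (v u : V) : {set E} :=
  \bigcup_(x | connect (avoid_rel v) u x) bagset x.

Definition nbrs (v : V) : seq V := [seq u <- enum V | adj v u].

Definition vflower (v : V) : seq {set E} :=
  if pt_isD T v then map (vpetal v) (pt_cord T v) else map (vpetal v) (nbrs v).

Definition tree_displays (X : {set E}) : Prop :=
  (exists u w, adj u w /\ X = eside u w /\ ksep X) \/
  (exists v, ~~ isbag v /\ flower_displays (vflower v) X).

Definition conforms (X : {set E}) : Prop :=
  strong_ksep X /\
  ((exists Y, tree_displays Y /\ tequiv X Y) \/
   (exists (Y : {set E}) (w : V), isbag w /\ (Y \subset pt_bag T w \/ ~: Y \subset pt_bag T w)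
                /\ tequiv X Y)).

Definition partial_tree : Prop :=
  pi_labelled /\
  (forall u w, adj u w ->
     strong_ksep (eside u w) && (isbag u && isbag w ==> kS_sep (eside u w))) /\
  (forall v, ~~ isbag v -> ~~ pt_isD T v ->
     anemone (vflower v) /\ Sorder_ge3 (vflower v) /\ no_loose_anemone (vflower v)) /\
  (forall v, ~~ isbag v -> pt_isD T v ->
     perm_eq (pt_cord T v) (nbrs v) /\
     daisy (vflower v) /\ Sorder_ge3 (vflower v) /\ no_loose_daisy (vflower v)) /\
  (forall X, kS_sep X -> conforms X).

End Tree.

Definition tree_le (T1 T2 : ptree E) : Prop :=
  forall X, kS_sep X -> tree_displays T1 X ->
    exists2 Y, kS_sep Y /\ tree_displays T2 Y & tequiv X Y.

Definition S_maximal (T : ptree E) : Prop :=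
  partial_tree T /\
  forall T' : ptree E, partial_tree T' -> tree_le T T' -> tree_le T' T.

End Defs.

(* Main.v *)
(** If the theorem fails, some (k,S)-separation not equivalent to a displayed one
    has a side inside a bag B; let N be the complement of B. Among the flowers with N inside
    one petal that display such a separation X with a closure of maximum size,
    choose one that represents the most (k,S)-separations by intervals of petals
    and, subject to this, has the most petals. Every (k,S)-separation Z with a
    side in B then conforms with it: shift Z within its class so that it crosses
    as few petals as possible. If Z cuts a petal A into two strong parts, then
    either the flower refines at A, or everything the flower represents is
    equivalent to A and the four quadrants of A and Z give a better flower.
    Otherwise Z cuts every petal into two weak parts; since eight weak sets do not
    cover E, there are at least five consecutive arcs, maximal among those cut
    into weak parts, and uncrossing Z with two of them removes a crossing.

    A flower with the fewest petals retaining these properties has no loose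
    petals. Attaching it to B as a star gives a partial tree above T that displays
    an undisplayed (k,S)-separation, against maximality. *)

(* [N] must stay inside one petal, because the rest of the tree will hang behind that petal; hence
   only shifts of Z with [N] on one side are compared. The largest closure serves a single case: Z
   equivalent to a set nested in a petal and containing [N]. The complement of that set then
   contains X, has no larger closure, and so is equivalent to X. Only intervals are counted as
   represented, because uncrossing controls arcs of petals and not arbitrary unions. The eight sets
   in (RT3) are four arcs times two sides of Z: four arcs cannot cover [E], so a fifth one starts,
   and the fourth arc with one more petal is a region away from the two arcs being uncrossed. A
   maximal flower may have loose petals, which the tree axioms forbid. The second choice, with the
   fewest petals, therefore keeps conformity and one undisplayed separation and gives up
   maximality. *)
Require Import Defs.
From mathcomp Require Import all_boot all_order all_algebra.
From mathcomp Require Import boolp zify.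
Import Order.TTheory GRing.Theory Num.Theory.

Set Implicit Arguments.
Unset Strict Implicit.
Unset Printing Implicit Defensive.

(** * Truth tables for set identities *)

Section SetDecision.
Variable E : finType.
Implicit Types A B : {set E}.

Lemma subset_pointwise A B : A \subset B -> forall x, (x \in A) ==> (x \in B).
Proof. by move=> /subsetP AB x; apply/implyP/AB. Qed.

Lemma disjoint_pointwise A B :
  [disjoint A & B] -> forall x, ~~ ((x \in A) && (x \in B)).
Proof. by move=> /pred0P AB x; apply/negbT/AB. Qed.

Lemma eqset_pointwise A B : A = B -> forall x, (x \in A) == (x \in B).
Proof. by move=> -> x. Qed.

Lemma pointwise_disjoint A B :
  (forall x, ~~ ((x \in A) && (x \in B))) -> [disjoint A & B].
Proof. by move=> AB; apply/pred0P=> x; apply/negbTE/AB. Qed.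

Lemma mem_bigcup_has (L : seq {set E}) x :
  (x \in \bigcup_(A <- L) A) = has (fun A : {set E} => x \in A) L.
Proof. by elim: L => [|A L IH]; rewrite ?big_nil ?big_cons inE//= IH. Qed.

End SetDecision.

(* Decides inclusions, disjointness and equalities of sets from such
   hypotheses, by a truth table at a generic point. *)
Ltac set_decide :=
  let x := fresh "x" in
  match goal with
  | |- is_true [disjoint _ & _] => apply: pointwise_disjoint => x
  | |- is_true (_ \subset _) => apply/subsetP => x; apply/implyP
  | |- @eq _ _ _ => apply/setP => x; apply/eqP
  end;
  repeat match goal with
  | H : is_true (_ \subset _) |- _ => move: (subset_pointwise H x); clear H
  | H : is_true [disjoint _ & _] |- _ =>
      move: (disjoint_pointwise H x); clear H
  | H : @eq {set _} _ _ |- _ => move: (eqset_pointwise H x); clear H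
  end;
  rewrite ?inE;
  repeat match goal with |- context [x \in ?A] => case: (x \in A) end;
  by [].


(** * Grafting a star onto a tree *)

Section Connectivity.
Variables (T1 T2 : finType) (e1 : rel T1) (e2 : rel T2).

Lemma connect_homo (f : T1 -> T2) :
  (forall x y, e1 x y -> connect e2 (f x) (f y)) ->
  forall x y, connect e1 x y -> connect e2 (f x) (f y).
Proof.
move=> fe x y /connectP[p]; elim: p x => [|z p IH] x /=; first by move=> _ ->.
by move=> /andP[exz pz] ey; apply: connect_trans (fe _ _ exz) (IH z pz ey).
Qed.

Lemma connect_invariant x y : connect e1 x y -> forall a : pred T1,
  (forall u v, e1 u v -> a u -> a v) -> a x -> a y.
Proof.
move=> + a ae; move=> /connectP[p]; elim: p x => [|z p IH] x /=; first by move=> _ ->.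
by move=> /andP[exz pz] ey ax; apply: IH pz ey (ae _ _ exz ax).
Qed.

Lemma not_connect (a : pred T1) x y :
  (forall u v, e1 u v -> a u -> a v) -> a x -> ~~ a y -> ~~ connect e1 x y.
Proof. by move=> ae ax; apply: contraNN => /connect_invariant; apply. Qed.

End Connectivity.

Lemma enum_sum (A B : finType) :
  enum {: A + B} = [seq inl u | u <- enum A] ++ [seq inr u | u <- enum B].
Proof. by rewrite !enumT [in LHS]unlock. Qed.

Lemma enum_option (A : finType) :
  enum {: option A} = None :: [seq Some u | u <- enum A].
Proof. by rewrite !enumT [in LHS]unlock. Qed.

(** * Sides of an edge in a labelled tree *)

Section TreeSides.
Variables (E : finType) (T : ptree E).
Hypothesis TP : pi_labelled T.

Lemma cut_relC u w : @cut_rel E T u w =2 cut_rel w u.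
Proof. by move=> x y; rewrite /cut_rel /= orbC. Qed.

Lemma cut_rel_sym u w : symmetric (@cut_rel E T u w).
Proof.
have [[_ [sT _]] _] := TP.
by move=> x y; rewrite /cut_rel /= sT orbC (andbC (y == w)) (andbC (y == u)).
Qed.

Lemma mem_eside u w x :
  reflect (exists2 v, connect (@cut_rel E T u w) u v & x \in bagset v)
          (x \in eside u w).
Proof. exact: bigcupP. Qed.

Lemma mem_vpetal v u x :
  reflect (exists2 w, connect (@avoid_rel E T v) u w & x \in bagset w)
          (x \in vpetal v u).
Proof. exact: bigcupP. Qed.

Lemma bagset_inj u w x : x \in @bagset E T u -> x \in bagset w -> u = w.
Proof.
have [_ [dT _]] := TP; rewrite /bagset.
case: ifP => [bu|_]; rewrite ?inE//; case: ifP => [bw|_]; rewrite ?inE// => xu xw.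
apply/eqP/negPn/negP => uw.
by have := disjoint_pointwise (dT u w bu bw uw) x; rewrite xu xw.
Qed.

Lemma bagset_cover x : exists w, x \in @bagset E T w.
Proof.
have [_ [_ cT]] := TP; have : x \in [set: E] by [].
by rewrite -cT => /bigcupP[w bw xw]; exists w; rewrite /bagset bw.
Qed.

(** Once the edge is cut, every vertex still reaches one of its ends, and the bridge condition
    forbids reaching both. Disjointness of the bags carries this from vertices to elements. *)
Lemma esideC u w : pt_adj T u w -> eside w u = ~: @eside E T u w.
Proof.
move=> uw; have [[_ [sT [_ [conn bridge]]]] _] := TP.
have csym := sym_connect_sym (@cut_rel_sym u w).
apply/setP => x; rewrite inE; apply/idP/idP.
  move=> /mem_eside[v wv xv]; apply/mem_eside => -[v' uv' xv'].
  rewrite -(bagset_inj xv xv') in uv'.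
  rewrite (eq_connect (cut_relC w u)) in wv.
  case/negP: (bridge u w uw); apply: connect_trans uv' _.
  by rewrite csym.
move=> nux; have [v xv] := bagset_cover x.
apply/mem_eside; exists v => //; rewrite (eq_connect (cut_relC w u)).
suff : connect (cut_rel u w) u v || connect (cut_rel u w) w v.
  by case/orP => // uv; case/mem_eside: nux; exists v.
apply: (connect_invariant (conn u v) (a := fun v =>
  connect (cut_rel u w) u v || connect (cut_rel u w) w v)); last by rewrite connect0.
move=> y z yz; have [cyz|] := boolP (cut_rel u w y z).
  by case/orP => cy; apply/orP; [left|right]; apply: connect_trans cy (connect1 cyz).
rewrite /cut_rel /= yz /= negbK => /orP[] /andP[_ /eqP->]; rewrite connect0 ?orbT//.
Qed.

End TreeSides.

(* The centre [inr None] of the star becomes a bag vertex with an empty bag when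
   the flower has only two petals, since it is then too small for a D- or
   A-vertex. *)
Section Graft.
Variables (E : finType) (T : ptree E) (b : pt_V T).
Variables (P0 : {set E}) (Ps : seq {set E}) (center_bag center_D : bool).

(** The old tree, a centre [inr None], and a leaf for each petal of [Ps]. The petal [P0] gets no
    leaf: the old tree itself hangs there, through [b]. *)
Definition graft_V : finType := (pt_V T + option 'I_(size Ps))%type.

Definition graft_adj : rel graft_V := fun x y =>
  match x, y with
  | inl u, inl w => pt_adj T u w
  | inl u, inr None | inr None, inl u => u == b
  | inr None, inr (Some _) | inr (Some _), inr None => true
  | _, _ => false
  end.

Definition graft_isbag (x : graft_V) : bool :=
  match x with inl u => pt_isbag T u | inr None => center_bag | _ => true end.

Definition graft_bag (x : graft_V) : {set E} :=
  match x with
  | inl u => if u == b then pt_bag T b :&: P0 else pt_bag T u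
  | inr None => set0
  | inr (Some i) => nth set0 Ps i
  end.

Definition graft_isD (x : graft_V) : bool :=
  if x is inl u then pt_isD T u else center_D.

Definition graft_star : seq graft_V :=
  inl b :: [seq inr (Some i) | i <- enum 'I_(size Ps)].

Definition graft_cord (x : graft_V) : seq graft_V :=
  if x is inl u then [seq inl w | w <- pt_cord T u] else graft_star.

Definition graft : ptree E :=
  @PTree E graft_V graft_adj graft_isbag graft_bag graft_isD graft_cord.

Definition retract (x : graft_V) : pt_V T := if x is inl u then u else b.

Hypothesis TP : pi_labelled T.
Hypothesis bP : pt_isbag T b.
Hypothesis dP : pairwise (fun A B : {set E} => [disjoint A & B]) (P0 :: Ps).
Hypothesis cP : P0 :|: \bigcup_(A <- Ps) A = setT.
Hypothesis PsB : all (fun A : {set E} => A \subset pt_bag T b) Ps.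

Lemma graft_petal_sub (i : 'I_(size Ps)) : nth set0 Ps i \subset pt_bag T b.
Proof. exact: (allP PsB _ (mem_nth set0 (ltn_ord i))). Qed.

Lemma graft_petal_disjoint0 (i : 'I_(size Ps)) : [disjoint P0 & nth set0 Ps i].
Proof. by move: dP => /= /andP[/allP d _]; apply: d; apply: mem_nth. Qed.

Lemma graft_petal_disjoint (i j : 'I_(size Ps)) : i != j ->
  [disjoint nth set0 Ps i & nth set0 Ps j].
Proof.
move: dP => /= /andP[_ /(pairwiseP set0) d] ij.
have : i != j :> nat by apply: contraNneq ij => /ord_inj->.
by case: ltngtP => // lt _; [|rewrite disjoint_sym]; apply: d; rewrite ?inE.
Qed.

Lemma graft_petal_cover x : x \notin P0 -> exists i : 'I_(size Ps), x \in nth set0 Ps i.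
Proof.
move=> xP0; have : x \in [set: E] by [].
rewrite -cP inE (negbTE xP0) /= => xU.
move: xU; rewrite mem_bigcup_has => /(has_nthP set0)[i iP xi].
by exists (Ordinal iP).
Qed.

Lemma graft_adj_sym : symmetric graft_adj.
Proof. by have [[_ [sT _]] _] := TP; move=> [u|[i|]] [w|[j|]] //=; apply: sT. Qed.

(** The leaves only redistribute the part of the bag of [b] outside [P0], so contracting the star
    onto [b] gives back the old bags. *)
Lemma mem_bagset_retract x u :
  (exists2 v : graft_V, retract v = u & x \in @bagset E graft v) <->
  x \in @bagset E T u.
Proof.
split=> [[[w|[i|]] /= <-]|].
- rewrite /bagset /=; case: ifP => // _.
  by case: eqP => // ->; rewrite inE => /andP[].
- by rewrite /bagset bP /= => xi; apply: (subsetP (graft_petal_sub i)).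
- by rewrite /bagset /=; case: ifP; rewrite inE.
rewrite /bagset; have [->|ub] := eqVneq u b.
  rewrite bP => xb; have [x0|x0] := boolP (x \in P0).
    by exists (inl b); rewrite //= bP eqxx inE xb x0.
  by have [i xi] := graft_petal_cover x0; exists (inr (Some i)).
by move=> xu; exists (inl u); rewrite //= (negbTE ub).
Qed.

(** The retraction sends each edge to an edge or collapses it, and each vertex is connected to its
    image, so connections are neither created nor lost. *)
Lemma connect_retract (e' : rel graft_V) (e : rel (pt_V T)) u x :
  (forall y z, e' y z -> e (retract y) (retract z) \/ retract y = retract z) ->
  (forall y z, e y z -> e' (inl y) (inl z)) ->
  (forall y, connect e' (inl (retract y)) y) ->
  connect e' (inl u) x = connect e u (retract x).
Proof.
move=> h1 h2 h3; apply/idP/idP => [|ux].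
  apply: (@connect_homo _ _ e' e retract) => y z /h1[/connect1//|->].
  exact: connect0.
apply: connect_trans (h3 x).
apply: (@connect_homo _ _ e e' inl) ux => y z /h2; exact: connect1.
Qed.

Lemma graft_cut_old u w x : pt_adj T u w ->
  connect (@cut_rel E graft (inl u) (inl w)) (inl u) x =
  connect (@cut_rel E T u w) u (retract x).
Proof.
move=> uw; apply: connect_retract.
- move=> [y|[i|]] [z|[j|]]; rewrite /cut_rel /=; try by [right|].
  + by move=> yz; left.
  + by move=> /andP[/eqP-> _]; right.
  + by move=> /andP[/eqP-> _]; right.
- by move=> y z.
have cb : connect (@cut_rel E graft (inl u) (inl w)) (inl b) (inr None).
  by apply: connect1; rewrite /cut_rel /= eqxx !andbF.
move=> [y|[i|]] //=; apply: connect_trans cb _.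
by apply: connect1; rewrite /cut_rel.
Qed.

(** The condition [v != b] keeps the whole star attached to [b] when [v] is avoided. *)
Lemma graft_avoid_old v u x : v != b -> u != v ->
  connect (@avoid_rel E graft (inl v)) (inl u) x =
  connect (@avoid_rel E T v) u (retract x).
Proof.
move=> vb uv; apply: connect_retract.
- move=> [y|[i|]] [z|[j|]]; rewrite /avoid_rel /=; try by [right|].
  + by move=> yz; left.
  + by move=> /andP[/eqP-> _]; right.
  + by move=> /andP[/eqP-> _]; right.
- by move=> y z.
have cb : connect (@avoid_rel E graft (inl v)) (inl b) (inr None).
  by apply: connect1; rewrite /avoid_rel /= !eqxx eq_sym vb.
move=> [y|[i|]] //=; apply: connect_trans cb _.
by apply: connect1; rewrite /avoid_rel.
Qed.

Lemma graft_is_tree : is_tree graft.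
Proof.
have [[_ [sT [iT [conn bridge]]]] _] := TP.
have conn0 x : connect graft_adj (inl b) x.
  have cb : connect graft_adj (inl b) (inr None).
    by apply: connect1; rewrite /= eqxx.
  case: x => [u|[i|]] //; last by apply: connect_trans cb (connect1 _).
  by apply: (@connect_homo _ _ (pt_adj T)) (conn b u) => x y xy; apply: connect1.
have csym := sym_connect_sym graft_adj_sym.
split; first by apply/card_gt0P; exists (inl b).
split; first exact: graft_adj_sym.
split; first by move=> [u|[i|]] //=; apply: iT.
split=> [x y|]; first by apply: connect_trans (conn0 y); rewrite csym.
move=> [u|[i|]] [w|[j|]] //= uw.
- by rewrite graft_cut_old//; apply: bridge.
- move/eqP: uw => ->.
  apply: (@not_connect _ _ (fun x => if x is inl _ then true else false)) => //.
  by move=> [y|[i|]] [z|[j|]]; rewrite /cut_rel /= ?eqxx // => /andP[/eqP->]; rewrite ?eqxx.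
- apply: (@not_connect _ _ (fun x => x == inr (Some i))) => //.
  move=> y z; rewrite /cut_rel /= => /andP[yz ny] /eqP ey.
  by move: yz ny; rewrite ey; case: z => [z|[j|]] //=; rewrite !eqxx.
- move/eqP: uw => ->.
  apply: (@not_connect _ _ (fun x => if x is inl _ then false else true)) => //.
  by move=> [y|[i|]] [z|[j|]]; rewrite /cut_rel /= ?eqxx // => /andP[/eqP->]; rewrite ?eqxx.
- apply: (@not_connect _ _ (fun x => x != inr (Some j))); rewrite ?negbK//.
  move=> y z; rewrite /cut_rel /= => /andP[yz ny] yj.
  apply: contraL ny => /eqP ez; move: yz; rewrite ez negbK.
  by case: y yj => [y|[i|]] //=; rewrite !eqxx.
Qed.

Lemma graft_pi_labelled : pi_labelled graft.
Proof.
have [_ [dT cT]] := TP; split; first exact: graft_is_tree.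
have sub u (x : E) : x \in graft_bag (inl u) -> x \in pt_bag T u.
  by rewrite /=; case: eqP => // ->; rewrite inE => /andP[].
split.
  have dol u (i : 'I_(size Ps)) : pt_isbag T u ->
      [disjoint graft_bag (inl u) & nth set0 Ps i].
    move=> bu; have := graft_petal_disjoint0 i; have := graft_petal_sub i.
    rewrite /=; have [_|ub] := eqVneq u b.
      by move=> _ d; apply: disjointWl d; apply: subsetIr.
    by move=> s _; apply: disjointWr s (dT _ _ bu bP ub).
  move=> [u|[i|]] [w|[j|]] bu bw uw; rewrite /=.
  - apply: pointwise_disjoint => x; apply/andP => -[/sub xu /sub xw].
    by have := disjoint_pointwise (dT u w bu bw uw) x; rewrite xu xw.
  - exact: dol.
  - by rewrite -setI_eq0 setI0.
  - by rewrite disjoint_sym; apply: dol.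
  - by apply: graft_petal_disjoint; apply: contraNneq uw => ->.
  - by rewrite -setI_eq0 setI0.
  - by rewrite -setI_eq0 set0I.
  - by rewrite -setI_eq0 set0I.
  - by rewrite -setI_eq0 set0I.
apply/eqP; rewrite -subTset; apply/subsetP => x _.
have [w xw] := bagset_cover TP x.
have /mem_bagset_retract[v _ xv] := xw.
apply/bigcupP; exists v; move: xv; rewrite /bagset; case: ifP => //; by rewrite inE.
Qed.

Lemma graft_eside_old u w : pt_adj T u w ->
  @eside E graft (inl u) (inl w) = eside u w.
Proof.
move=> uw; apply/setP => x; apply/mem_eside/mem_eside => [[v]|[y uy xy]].
  rewrite graft_cut_old// => uv xv; exists (retract v) => //.
  by apply/mem_bagset_retract; exists v.
have /mem_bagset_retract[v vy xv] := xy; exists v => //.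
by rewrite graft_cut_old// vy.
Qed.

Lemma graft_vpetal_old v u : v != b -> u != v ->
  @vpetal E graft (inl v) (inl u) = vpetal v u.
Proof.
move=> vb uv; apply/setP => x; apply/mem_vpetal/mem_vpetal => [[w]|[y uy xy]].
  rewrite graft_avoid_old// => uw xw; exists (retract w) => //.
  by apply/mem_bagset_retract; exists w.
have /mem_bagset_retract[w wy xw] := xy; exists w => //.
by rewrite graft_avoid_old// wy.
Qed.

Lemma bagset_leaf i : @bagset E graft (inr (Some i)) = nth set0 Ps i.
Proof. by []. Qed.

Lemma bagset_center : @bagset E graft (inr None) = set0.
Proof. by rewrite /bagset; case: ifP. Qed.

(** The petals in [Ps] lie in the bag of [b], so the other old bags avoid them and lie in [P0], as
    does what remains at [b]. *)
Lemma bagset_inl_sub x : x \in P0 <-> exists u, x \in @bagset E graft (inl u).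
Proof.
split=> [x0|[u]].
  have [w /mem_bagset_retract[[u|[i|]] _ xv]] := bagset_cover TP x.
  - by exists u.
  - have := disjoint_pointwise (graft_petal_disjoint0 i) x.
    by rewrite x0 -bagset_leaf xv.
  - by rewrite bagset_center inE in xv.
rewrite /bagset /=; case: ifP => [bu|]; rewrite ?inE//.
case: eqP => [_|/eqP ub xu]; first by rewrite inE => /andP[].
apply/negPn/negP => /graft_petal_cover[i xi].
have [_ [dT _]] := TP; have := disjoint_pointwise (dT u b bu bP ub) x.
by rewrite xu (subsetP (graft_petal_sub i) _ xi).
Qed.

Lemma graft_eside_leaf i : @eside E graft (inr (Some i)) (inr None) = nth set0 Ps i.
Proof.
apply/setP => x; apply/mem_eside/idP => [[v cv xv]|xi]; last first.
  by exists (inr (Some i)); rewrite ?connect0.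
have /eqP ev : v == inr (Some i).
  apply: (connect_invariant cv (a := fun y => y == inr (Some i))) => // y z.
  rewrite /cut_rel /= => /andP[yz ny] /eqP ey.
  by move: yz ny; rewrite ey; case: z => [z|[j|]] //=; rewrite !eqxx.
by rewrite ev in xv.
Qed.

Definition is_old (x : graft_V) := if x is inl _ then true else false.

Lemma mem_old_part (e : rel graft_V) v x : connect e (inl b) v ->
  (forall y z, e y z -> is_old y -> is_old z) -> x \in @bagset E graft v -> x \in P0.
Proof.
move=> cv inv; have := connect_invariant cv inv isT.
by case: v {cv} => // u _ xu; apply/bagset_inl_sub; exists u.
Qed.

Lemma connect_old (e : rel graft_V) u :
  (forall y z, pt_adj T y z -> e (inl y) (inl z)) -> connect e (inl b) (inl u).
Proof.
have [[_ [_ [_ [conn _]]]] _] := TP => eh.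
apply: (@connect_homo _ _ (pt_adj T) e inl _ b u (conn b u)) => y z yz.
exact/connect1/eh.
Qed.

Lemma graft_eside_old_center : @eside E graft (inl b) (inr None) = P0.
Proof.
apply/setP => x; apply/mem_eside/idP => [[v cv xv]|/bagset_inl_sub[u xu]].
  apply: mem_old_part cv _ xv.
  move=> [y|[i|]] [z|[j|]]; rewrite /cut_rel /= ?eqxx // => /andP[/eqP->].
  by rewrite ?eqxx.
by exists (inl u) => //; apply: connect_old => y z yz; rewrite /cut_rel /= yz; case: eqP.
Qed.

Lemma graft_vpetal_leaf i : @vpetal E graft (inr None) (inr (Some i)) = nth set0 Ps i.
Proof.
apply/setP => x; apply/mem_vpetal/idP => [[v cv xv]|xi]; last first.
  by exists (inr (Some i)); rewrite ?connect0.
have /eqP ev : v == inr (Some i).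
  apply: (connect_invariant cv (a := fun y => y == inr (Some i))) => // y z.
  rewrite /avoid_rel /= => /and3P[yz y0 z0] /eqP ey.
  by move: yz z0; rewrite ey; case: z => [z|[j|]].
by rewrite ev in xv.
Qed.

Lemma graft_vpetal_old_center : @vpetal E graft (inr None) (inl b) = P0.
Proof.
apply/setP => x; apply/mem_vpetal/idP => [[v cv xv]|/bagset_inl_sub[u xu]].
  apply: mem_old_part cv _ xv.
  by move=> [y|[i|]] [z|[j|]]; rewrite /avoid_rel /= ?andbF.
by exists (inl u) => //; apply: connect_old => y z yz; rewrite /avoid_rel /= yz.
Qed.

Lemma enum_graft : enum graft_V =
  [seq inl u | u <- enum (pt_V T)] ++
  inr None :: [seq inr (Some i) | i <- enum 'I_(size Ps)].
Proof.
by rewrite /graft_V enum_sum enum_option /= -map_comp.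
Qed.

Lemma graft_nbrs_old v : v != b ->
  @nbrs E graft (inl v) = [seq inl u | u <- nbrs v].
Proof.
move=> vb; rewrite /nbrs enum_graft filter_cat filter_map /= (negbTE vb).
by rewrite filter_map /= filter_pred0 cats0.
Qed.

Lemma graft_nbrs_center : @nbrs E graft (inr None) = graft_star.
Proof.
rewrite /nbrs enum_graft filter_cat /graft_star -[RHS]cat1s; congr cat.
  rewrite filter_map (@eq_filter _ _ (pred1 b))//.
  by rewrite filter_pred1_uniq ?enum_uniq ?mem_enum.
rewrite /= filter_map (@eq_filter _ _ predT)//.
by rewrite (all_filterP _)//; apply/allP.
Qed.

Lemma graft_vflower_old v : v != b -> irreflexive (pt_adj T) ->
  (pt_isD T v -> perm_eq (pt_cord T v) (nbrs v)) ->
  @vflower E graft (inl v) = vflower v.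
Proof.
move=> vb iT pv; rewrite /vflower /= graft_nbrs_old//.
have old u : u \in nbrs v -> @vpetal E graft (inl v) (inl u) = vpetal v u.
  rewrite mem_filter => /andP[vu _]; apply: graft_vpetal_old => //.
  by apply: contraTneq vu => ->; rewrite iT.
case: ifP => Dv; rewrite -map_comp; apply/eq_in_map => u /= uv; apply: old => //.
by rewrite -(perm_mem (pv Dv)).
Qed.

(** Both labels of the centre give the same list, because [graft_star] is at once the cyclic order
    and the enumeration of its neighbours. *)
Lemma graft_vflower_center : @vflower E graft (inr None) = P0 :: Ps.
Proof.
rewrite /vflower graft_nbrs_center /= if_same /graft_star /=.
rewrite graft_vpetal_old_center -map_comp; congr (_ :: _).
rewrite (eq_map (_ : _ =1 fun i : 'I_(size Ps) => nth set0 Ps i)).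
  by rewrite (map_comp (nth set0 Ps) val) val_enum_ord map_nth_iota0 ?take_size.
by move=> i; apply: graft_vpetal_leaf.
Qed.

End Graft.
(** * Separations, closures and flowers *)

Section Separations.
Variables (E : finType) (lam : {set E} -> int) (k : nat).
Variables (Tg S : {set {set E}}).
Hypothesis lamP : connectivity_system lam.
Hypothesis TgP : robust_tangle lam k Tg.
Implicit Types A B X Y Z F : {set E}.

Local Notation ksep := (ksep lam k).
Local Notation fcl := (fcl lam k Tg).
Local Notation fully_closed := (fully_closed lam k Tg).
Local Notation weak := (weak Tg).
Local Notation strong := (strong Tg).

(** * Uncrossing and small sets *)

Lemma lamC X : lam (~: X) = lam X.
Proof. by rewrite -(proj1 lamP). Qed.

Lemma ksepC X : ksep (~: X) = ksep X.
Proof. by rewrite /Defs.ksep lamC. Qed.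

Lemma ksep_uncross X Y : ksep X -> ksep Y ->
  (k%:Z <= lam (X :|: Y))%R -> ksep (X :&: Y).
Proof.
rewrite /Defs.ksep => kX kY kU; have := proj2 lamP X Y; lia.
Qed.

Lemma ksepT X : ksep X -> ksep setT.
Proof.
rewrite /Defs.ksep => kX; have := proj2 lamP X (~: X).
rewrite setUCr setICr -setCT !lamC; lia.
Qed.

(* If the tangle is empty then no set is weak; counting the empty set as
   small makes big petals nonempty in that degenerate case too. *)
Definition small X := (X == set0) || weak X.
Local Notation big X := (~~ small X).

Lemma smallS X Y : X \subset Y -> small Y -> small X.
Proof.
move=> XY /orP[/eqP Y0|/existsP[A /andP[AT YA]]]; apply/orP.
  by left; rewrite -subset0 -Y0.
by right; apply/existsP; exists A; rewrite AT (subset_trans XY YA).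
Qed.

Lemma bigS X Y : X \subset Y -> big X -> big Y.
Proof. by move=> XY; apply/contra/smallS. Qed.

Lemma small0 : small set0.
Proof. by rewrite /small eqxx. Qed.

Lemma big_neq0 X : big X -> X != set0.
Proof. by apply: contraNneq => ->; apply: small0. Qed.

Lemma big_strong X : big X -> strong X.
Proof. by rewrite negb_or => /andP[]. Qed.

Lemma small_weak X : small X -> X != set0 -> weak X.
Proof. by move=> /orP[->|]. Qed.

Lemma low_small X : (lam X < k%:Z)%R -> small X \/ small (~: X).
Proof.
move=> lX; have lX1 : (lam X <= k%:Z - 1)%R by lia.
have [_ [T2 _]] := TgP.
by case: (T2 X lX1) => XT; [left|right]; apply/orP; right; apply/existsP;
  [exists X|exists (~: X)]; rewrite XT subxx.
Qed.

Lemma big_lam X : big X -> big (~: X) -> (k%:Z <= lam X)%R.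
Proof.
move=> bX bXC; rewrite leNgt; apply/negP => /low_small[] sX.
  by rewrite sX in bX.
by rewrite sX in bXC.
Qed.

Lemma small_cover_neq (s : seq {set E}) : [set: E] != set0 -> size s <= 8 ->
  all small s -> \bigcup_(A <- s) A != setT.
Proof.
move=> ET s8 ss; have [_ [_ [T3 _]]] := TgP.
(* In an empty tangle only the empty set is small. *)
have [[M MT]|T0] := pselect (exists M, M \in Tg); last first.
  rewrite big_seq big1 ?(eq_sym set0)// => A As.
  have /orP[/eqP//|/existsP[M /andP[MT _]]] := allP ss A As.
  by case: T0; exists M.
have hull A : exists M', (M' \in Tg) && (small A ==> (A \subset M')).
  case: (boolP (small A)) => [/orP[/eqP->|/existsP[M' M'P]]|_].
  - by exists M; rewrite MT sub0set.
  - by exists M'.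
  - by exists M; rewrite MT.
pose h A := xchoose (hull A).
have hT A : h A \in Tg by have /andP[] := xchooseP (hull A).
have hS A : A \in s -> A \subset h A.
  by move=> As; have /andP[_ /implyP] := xchooseP (hull A); apply; apply: (allP ss).
(* Padding to eight: past the end of [s] the default [set0] is read, and its hull is again a member
   of the tangle. *)
have := T3 (fun i : 'I_8 => h (nth set0 s i)) (fun i => hT _).
apply: contraNneq => sT; rewrite eqEsubset subsetT /= -{1}sT.
rewrite big_tnth; apply/bigcupsP => i _.
have i8 : i < 8 by apply: leq_trans (ltn_ord i) s8.
apply: subset_trans (bigcup_sup (Ordinal i8) _) => //=.
by rewrite (tnth_nth set0) hS ?mem_nth.
Qed.

(** Uncrossing without numbers: a set that is big together with its complement has connectivity at
    least [k], so submodularity leaves at most [k] for the intersection. *)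
Lemma ksep_capW X Y : ksep X -> ksep Y -> big (X :|: Y) ->
  big (~: (X :|: Y)) -> ksep (X :&: Y).
Proof. by move=> kX kY b1 b2; apply: ksep_uncross => //; apply: big_lam. Qed.

Lemma ksep_cupW X Y : ksep X -> ksep Y -> big (X :&: Y) ->
  big (~: (X :&: Y)) -> ksep (X :|: Y).
Proof.
move=> kX kY b1 b2; rewrite -ksepC setCU.
by apply: ksep_capW; rewrite ?ksepC// -setCI ?setCK.
Qed.

Lemma ksep_diffW X Y : ksep X -> ksep Y -> big (Y :\: X) ->
  big (~: (Y :\: X)) -> ksep (X :\: Y).
Proof.
move=> kX kY b1 b2; rewrite setDE; apply: ksep_capW; rewrite ?ksepC//.
  by rewrite (_ : _ :|: _ = ~: (Y :\: X)) //; set_decide.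
by rewrite (_ : ~: (_ :|: _) = Y :\: X) //; set_decide.
Qed.

(** * Full closures *)

Lemma fcl_sub X : X \subset fcl X.
Proof. by apply/bigcapsP => F /andP[]. Qed.

Lemma fclS X F : fully_closed F -> X \subset F -> fcl X \subset F.
Proof. by move=> FF XF; apply: bigcap_inf; rewrite FF. Qed.

Lemma fcl_mono X Y : X \subset fcl Y -> fcl X \subset fcl Y.
Proof.
move=> XY; apply/bigcapsP => F /andP[FF YF]; apply: fclS => //.
by apply: subset_trans XY (fclS _ _).
Qed.

Lemma fcl_idem X Y : X \subset Y -> Y \subset fcl X -> fcl Y = fcl X.
Proof.
move=> XY YX; apply/eqP; rewrite eqEsubset !fcl_mono//.
exact: subset_trans XY (fcl_sub Y).
Qed.

(** A nonempty small complement could be added to [F] at once, because [E] itself is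
    k-separating. *)
Lemma fully_closed_compl F : fully_closed F -> small (~: F) -> F = setT.
Proof.
move=> /and3P[sF kF /forallP FF] sFC; apply/eqP; rewrite -subTset.
rewrite -setCS setCT subset0; apply/negPn/negP => F0.
have := FF (~: F); rewrite F0 (small_weak sFC F0) subxx /= setUCr.
by rewrite (ksepT kF).
Qed.

Lemma fcl_neqT X : fcl X != setT -> big (~: fcl X).
Proof.
apply: contraNN => sX; rewrite eqEsubset subsetT; apply/bigcapsP => F /andP[FF XF].
by rewrite (fully_closed_compl FF)//; apply: smallS sX; rewrite setCS fclS.
Qed.

(** Uncrossing a fully closed [F] above [X] with [X :|: Y] makes [F :|: Y] k-separating, so [F] can
    leave out nothing of the small set [Y]. *)
Lemma fcl_step X Y : big X -> ksep X -> small Y -> ksep (X :|: Y) ->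
  X :|: Y \subset fcl X.
Proof.
move=> bX kX sY kXY; apply/bigcapsP => F /andP[FF XF].
rewrite subUset XF /=.
have /and3P[sF kF /forallP FFY] := FF.
case: (boolP (small (~: F))) => [sFC|bFC].
  by rewrite (fully_closed_compl FF sFC) subsetT.
have kU : ksep (F :|: Y).
  rewrite (_ : F :|: Y = F :|: (X :|: Y)); last by set_decide.
  apply: ksep_cupW => //; first by apply: bigS bX; set_decide.
  by apply: bigS bFC; set_decide.
rewrite -setD_eq0; apply/negPn/negP => Y0.
have := FFY (Y :\: F); rewrite Y0 (small_weak (smallS _ sY) Y0) ?subsetDl//.
by rewrite subsetDr setDE setUIr setUCr setIT kU.
Qed.

(** The closure is an intersection, so it is approached from inside: take a largest k-separating [Z]
    below it for which [~: X] still lies in the closure of [~: (Z :&: X')]. A weak set extending [Z]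
    removes only a small piece from that complement, and [fcl_step] restores it. So [Z] is fully
    closed and contains [X']. *)
Lemma fcl_compl_eq X X' : big X -> ksep X -> ksep X' -> fcl X != setT ->
  X \subset X' -> X' \subset fcl X -> fcl (~: X') = fcl (~: X).
Proof.
move=> bX kX kX' fX XX' X'f; have bfC := fcl_neqT fX.
have bXC' : big (~: X') by apply: bigS bfC; rewrite setCS.
symmetry; apply: fcl_idem; first by rewrite setCS.
pose Q Z := [&& X \subset Z, Z \subset fcl X, ksep Z, ksep (Z :&: X') &
  ~: X \subset fcl (~: (Z :&: X'))].
have QX : Q X.
  by rewrite /Q subxx fcl_sub kX (setIidPl XX') kX fcl_sub.
case: (@arg_maxnP _ X Q (fun Z => #|Z|) QX) => Z /and5P[XZ Zf kZ kZX' XCf] Zmax.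
have [FZ|nFZ] := boolP (fully_closed Z).
  by rewrite (_ : Z :&: X' = X') in XCf => //; apply/setIidPr/(subset_trans X'f)/fclS.
have bZ := bigS XZ bX.
rewrite /Defs.fully_closed kZ (big_strong bZ) /= negb_forall in nFZ.
have /existsP[Y] := nFZ.
rewrite negb_imply negbK => /andP[/and3P[Y0 wY YZ] kZY].
have sY : small Y by rewrite /small wY orbT.
have ZYf : Z :|: Y \subset fcl X.
  by rewrite -(fcl_idem XZ Zf) fcl_step.
suff /Zmax : Q (Z :|: Y).
  rewrite /= leqNgt (_ : #|Z| < #|Z :|: Y|)//; apply: proper_card.
  rewrite properE subsetUl /=; apply: contra Y0 => /subUsetP[_ YZ'].
  by rewrite -subset0 -(setICr Z) subsetI YZ'.
have kZYX : ksep ((Z :|: Y) :&: X').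
  apply: ksep_capW => //; first by apply: bigS bZ; set_decide.
  by apply: bigS bfC; set_decide.
rewrite /Q ZYf kZY kZYX (subset_trans XZ (subsetUl _ _)) /=.
apply: subset_trans XCf _; apply: fcl_mono.
rewrite (_ : ~: (Z :&: X') = ~: ((Z :|: Y) :&: X') :|: (Y :&: X')); last first.
  by set_decide.
apply: fcl_step; rewrite ?ksepC//.
- by apply: bigS bXC'; set_decide.
- by apply: smallS sY; set_decide.
- rewrite (_ : _ :|: _ = ~: (Z :&: X')) ?ksepC//.
  by set_decide.
Qed.


Hypothesis SP : tree_compatible lam k Tg S.

Local Notation kS := (kS_sep lam k S).
Local Notation tequiv := (tequiv lam k Tg).
Local Notation strong_ksep := (strong_ksep lam k Tg).

(** * Equivalence of (k,S)-separations *)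

Definition same_closures X Y :=
  (fcl X == fcl Y) && (fcl (~: X) == fcl (~: Y)).

Lemma same_closures_sym X Y : same_closures X Y = same_closures Y X.
Proof. by rewrite /same_closures eq_sym (eq_sym (fcl (~: X))). Qed.

Lemma same_closures_trans X Y Z :
  same_closures X Y -> same_closures Y Z -> same_closures X Z.
Proof. by rewrite /same_closures => /andP[/eqP-> /eqP->]. Qed.

Lemma same_closuresC X Y : same_closures (~: X) (~: Y) = same_closures X Y.
Proof. by rewrite /same_closures !setCK andbC. Qed.

Lemma kSC X : kS (~: X) = kS X.
Proof. by rewrite /kS_sep ksepC setCK [X in _ && X]andbC. Qed.

Lemma kS_ksep X : kS X -> ksep X.
Proof. by case/and3P. Qed.

Lemma kS_fcl X : kS X -> fcl X != setT.
Proof.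
case/and3P=> kX XS XCS; have [SP1 _] := SP.
have /and3P[_ _ sX] := SP1 _ XCS.
have /and3P[kXC] := SP1 _ XCS.
by rewrite /tsequential kXC sX /= setCK.
Qed.

Lemma kS_big_compl X : kS X -> big (~: X).
Proof. by move=> /kS_fcl/fcl_neqT; apply: bigS; rewrite setCS fcl_sub. Qed.

Lemma kS_big X : kS X -> big X.
Proof. by rewrite -kSC => /kS_big_compl; rewrite setCK. Qed.

Lemma kS_strong X : kS X -> strong_ksep X.
Proof.
by move=> kX; rewrite /Defs.strong_ksep !big_strong ?kS_big ?kSC// kS_ksep.
Qed.

Lemma tequiv_sym X Y : tequiv X Y = tequiv Y X.
Proof.
rewrite /Defs.tequiv andbCA; congr [&& _, _ & _].
by rewrite (eq_sym (fcl X)) (eq_sym (fcl (~: X))) (eq_sym (fcl X))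
  (eq_sym (fcl (~: X)) (fcl Y)) [X in _ || X]andbC.
Qed.

Lemma tequiv_kS X Y : kS X -> tequiv X Y -> kS Y.
Proof.
have [_ [SP2 _]] := SP => kX XY.
by apply: (SP2 X) => //; case/and3P: XY.
Qed.

Lemma tequiv_trans X Y Z : tequiv X Y -> tequiv Y Z -> tequiv X Z.
Proof.
case/and3P=> sX sY e1 /and3P[_ sZ e2]; rewrite /Defs.tequiv sX sZ /=.
by move: e1 e2; case/orP=> /andP[/eqP-> /eqP->] //; case/orP=> /andP[/eqP-> /eqP->];
  rewrite !eqxx ?orbT.
Qed.

Lemma tequiv_refl X : kS X -> tequiv X X.
Proof. by move=> kX; rewrite /Defs.tequiv kS_strong// !eqxx. Qed.

Lemma tequiv_compl X : kS X -> tequiv X (~: X).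
Proof.
by move=> kX; rewrite /Defs.tequiv !kS_strong ?kSC// setCK !eqxx orbT.
Qed.

Lemma same_closures_tequiv X Y : kS X -> kS Y -> same_closures X Y -> tequiv X Y.
Proof.
by move=> kX kY /andP[e1 e2]; rewrite /Defs.tequiv !kS_strong// e1 e2.
Qed.

(** Inside the closure neither of the two closures changes, by [fcl_idem] and [fcl_compl_eq]; (S1)
    then applies. *)
Lemma kS_between X X' : kS X -> ksep X' -> X \subset X' -> X' \subset fcl X ->
  kS X' /\ same_closures X' X.
Proof.
move=> kX kX' XX' X'f.
have sc : same_closures X X'.
  rewrite /same_closures (fcl_idem XX' X'f) eqxx eq_sym.
  by rewrite (fcl_compl_eq (kS_big kX) (kS_ksep kX) kX' (kS_fcl kX) XX' X'f) eqxx.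
rewrite same_closures_sym sc; split=> //; apply: (tequiv_kS kX).
rewrite /Defs.tequiv kS_strong// /Defs.strong_ksep kX'.
rewrite (big_strong (bigS XX' (kS_big kX))) big_strong/=; last first.
  by apply: bigS (fcl_neqT (kS_fcl kX)); rewrite setCS.
by case/andP: sc => -> ->.
Qed.

Lemma kS_addsmall X Y : kS X -> small Y -> ksep (X :|: Y) ->
  kS (X :|: Y) /\ same_closures (X :|: Y) X.
Proof.
move=> kX sY kXY; apply: kS_between => //; first exact: subsetUl.
by apply: fcl_step => //; [apply: kS_big|apply: kS_ksep].
Qed.

Lemma kS_delsmall X Y : kS X -> small Y -> ksep (X :\: Y) ->
  kS (X :\: Y) /\ same_closures (X :\: Y) X.
Proof.
move=> kX sY kXY; have XY : ~: (X :\: Y) = ~: X :|: Y by set_decide.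
by rewrite -kSC -same_closuresC XY; apply: kS_addsmall; rewrite ?kSC// -XY ksepC.
Qed.

(* If both parts were small, then all of [X] could be absorbed by the closure
   of its complement, the parts being k-separating by uncrossing. *)
Lemma kS_split_big X Y : kS X -> ksep Y ->
  small (X :&: Y) -> small (X :\: Y) -> False.
Proof.
move=> kX kY s1 s2.
have kX' := kS_ksep kX; have bX := kS_big kX; have bXC := kS_big_compl kX.
have fXC : fcl (~: X) != setT by rewrite kS_fcl// kSC.
(* If both parts of [~: X] were small as well, four small sets would cover [E]. So one of them is
   big, and complementing [Y] makes it [~: X :&: Y]. *)
wlog bY : Y kY s1 s2 / big (~: X :&: Y) => [H|].
  have [s3|] := boolP (small (~: X :&: Y)); last exact: H.
  have [s4|b4] := boolP (small (~: X :\: Y)); last first.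
    by apply: (H (~: Y)); rewrite ?ksepC ?setDE ?setCK// -setDE.
  have E0 : [set: E] != set0.
    by apply: contraNneq bX => E0; apply: smallS (small0); rewrite -E0 subsetT.
  have := @small_cover_neq [:: X :&: Y; X :\: Y; ~: X :&: Y; ~: X :\: Y] E0 isT.
  rewrite /= s1 s2 s3 s4 => /(_ isT)/eqP[].
  rewrite !big_cons big_nil.
  by set_decide.
have kXY : ksep (X :\: Y).
  by apply: ksep_diffW => //; [apply: bigS bY|apply: bigS bX]; set_decide.
have f1 : ~: X :|: (X :&: Y) \subset fcl (~: X).
  apply: fcl_step; rewrite ?ksepC//.
  by rewrite (_ : _ :|: _ = ~: (X :\: Y)) ?ksepC//; set_decide.
have : setT \subset fcl (~: X :|: (X :&: Y)).
  rewrite (_ : setT = (~: X :|: (X :&: Y)) :|: (X :\: Y)); last by set_decide.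
  apply: fcl_step => //; first by apply: bigS bXC; rewrite subsetUl.
    by rewrite (_ : _ :|: _ = ~: (X :\: Y)) ?ksepC//; set_decide.
  rewrite (_ : _ :|: _ = setT) ?(ksepT kX')//; set_decide.
rewrite (fcl_idem _ f1) ?subsetUl// subTset => /eqP fT.
by rewrite fT eqxx in fXC.
Qed.

(** * Flowers as lists of petals *)

Implicit Types P L M : seq {set E}.

Local Notation U L := (\bigcup_(A <- L) A).
Local Notation disjoint_petals := (pairwise (fun A B : {set E} => [disjoint A & B])).

Lemma bigcup_cons_seq A L : U (A :: L) = A :|: U L.
Proof. by rewrite big_cons. Qed.

Lemma bigcup_cat_seq L M : U (L ++ M) = U L :|: U M.
Proof. by rewrite big_cat. Qed.

Lemma bigcup_seq1_set A : U [:: A] = A.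
Proof. by rewrite big_seq1. Qed.

Lemma mem_bigcup_seq A L : A \in L -> A \subset U L.
Proof.
elim: L => // B L IH; rewrite inE big_cons => /predU1P[->|/IH AL].
  exact: subsetUl.
exact: subset_trans AL (subsetUr _ _).
Qed.

Lemma bigcup_seq_sub L X : (U L \subset X) = all (fun A => A \subset X) L.
Proof. by elim: L => [|A L IH]; rewrite ?big_nil ?sub0set// big_cons subUset IH. Qed.

Lemma bigcup_seq_disjoint L X :
  [disjoint U L & X] = all (fun A => [disjoint A & X]) L.
Proof.
elim: L => [|A L IH]; rewrite ?big_nil; first by rewrite -setI_eq0 set0I eqxx.
by rewrite big_cons /= -IH -!setI_eq0 setIUl setU_eq0.
Qed.

Lemma disjoint_petals_cat L M : disjoint_petals (L ++ M) ->
  [/\ disjoint_petals L, disjoint_petals M & [disjoint U L & U M]].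
Proof.
rewrite pairwise_cat => /and3P[/allrelP LM dL dM]; split=> //.
rewrite bigcup_seq_disjoint; apply/allP => A AL.
rewrite disjoint_sym bigcup_seq_disjoint; apply/allP => B BM.
by rewrite disjoint_sym LM.
Qed.

(* A flower in linear form: wrapping around is covered by complementation. *)
Definition list_flower P : Prop :=
  [/\ all (fun A => big A) P, disjoint_petals P, U P = setT &
      forall L1 L2 L3, P = L1 ++ L2 ++ L3 -> ksep (U L2)].

Lemma ksep0 X : ksep X -> ksep set0.
Proof. by move=> /ksepT kT; rewrite -setCT ksepC. Qed.

Lemma list_flower3 L1 L2 L3 : list_flower (L1 ++ L2 ++ L3) ->
  [/\ [disjoint U L1 & U L2], [disjoint U L1 & U L3], [disjoint U L2 & U L3] &
      U L1 :|: (U L2 :|: U L3) = setT].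
Proof.
case=> _ dP cP _; rewrite -cP !bigcup_cat_seq.
have [d1 /disjoint_petals_cat[d2 d3 d23]] := disjoint_petals_cat dP.
rewrite bigcup_cat_seq => d123; split=> //; set_decide.
Qed.

Lemma list_flower_big P L : list_flower P -> {subset L <= P} -> L != [::] ->
  big (U L).
Proof.
case: L => // A L [/allP bP _ _ _] LP _.
by apply: bigS (bP A _); rewrite ?LP ?mem_head// mem_bigcup_seq ?mem_head.
Qed.

Lemma list_flower_rot1 A L : list_flower (A :: L) -> list_flower (L ++ [:: A]).
Proof.
case=> bP dP cP kP.
have cP' : U (L ++ [:: A]) = setT.
  by rewrite -cP -(cat1s A L) !bigcup_cat_seq setUC.
have dP' : disjoint_petals (L ++ [:: A]).
  move: dP; rewrite -cat1s => /disjoint_petals_cat[_ dL dAL].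
  rewrite pairwise_cat dL /= andbT allrel1r.
  rewrite bigcup_seq1_set disjoint_sym in dAL.
  by move: dAL; rewrite bigcup_seq_disjoint => ->.
split=> //; first by move: bP; rewrite all_cat /= andbT andbC.
move=> L1 L2; case/lastP=> [|L3 B]; last first.
  rewrite -rcons_cat -rcons_cat cats1 => /rcons_inj[eL eB].
  by apply: (kP (A :: L1) L2 L3); rewrite eL.
rewrite cats0; case/lastP: L2 => [|L2 B].
  by rewrite big_nil => _; apply: ksep0 (kP [::] (A :: L) [::] _); rewrite ?cats0.
rewrite -rcons_cat cats1 => /rcons_inj[eL eB].
(* An interval that ends with the moved petal wraps around in the original list; its complement is
   the prefix [L1], which is an interval there. *)
rewrite (_ : U (rcons L2 B) = ~: U L1).
  by rewrite ksepC; apply: (kP [:: A] L1 L2); rewrite eL.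
move: dP' cP'; rewrite eL eB cats1 rcons_cat => /disjoint_petals_cat[_ _ d12].
by rewrite bigcup_cat_seq => c12; set_decide.
Qed.

Lemma list_flower_rot n P : list_flower P -> list_flower (rot n P).
Proof.
have rot_cat L M : list_flower (L ++ M) -> list_flower (M ++ L).
  elim: L M => [|A L IH] M; first by rewrite cats0.
  by move=> /list_flower_rot1; rewrite -catA => /IH; rewrite -catA.
by rewrite -{1}(cat_take_drop n P); apply: rot_cat.
Qed.

(** The complement stands for the arcs that wrap around the end of the list, which makes the notion
    invariant under rotation. *)
Definition interval_union P Y : Prop :=
  exists L1 L2 L3, P = L1 ++ L2 ++ L3 /\ (Y = U L2 \/ Y = ~: U L2).

Lemma interval_unionC P Y : interval_union P (~: Y) -> interval_union P Y.
Proof.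
move=> [L1 [L2 [L3 [eP eY]]]]; exists L1, L2, L3; split=> //.
by case: eY => /(congr1 (fun X => ~: X)); rewrite !setCK; [right|left].
Qed.

Lemma interval_union_rot n P Y : list_flower P ->
  interval_union P Y -> interval_union (rot n P) Y.
Proof.
have step A L : list_flower (A :: L) -> interval_union (A :: L) Y ->
    interval_union (L ++ [:: A]) Y.
  move=> fP [[|B L1] [L2 [L3 [/= eP eY]]]]; last first.
    exists L1, L2, (L3 ++ [:: A]); split=> //.
    by case: eP => _ ->; rewrite -!catA.
  case: L2 eP eY => [|B L2] /= eP eY.
    by exists [::], [::], (L ++ [:: A]).
  exists L2, L3, [:: A]; split; first by case: eP => -> ->; rewrite catA.
  have {eP}e : A :: L = [::] ++ (B :: L2) ++ L3 by [].
  rewrite e in fP; have [_ _ d c] := list_flower3 fP.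
  have e1 : U (B :: L2) = ~: U L3 by rewrite big_nil in c; set_decide.
  by rewrite e1 setCK in eY; case: eY; [right|left].
have rot_cat L M : list_flower (L ++ M) -> interval_union (L ++ M) Y ->
    interval_union (M ++ L) Y.
  elim: L M => [|A L IH] M; first by rewrite cats0.
  move=> fP iY; have := step _ _ fP iY; have := list_flower_rot1 fP.
  by rewrite -catA => f1 /(IH _ f1); rewrite -catA.
by rewrite -{1 2}(cat_take_drop n P); apply: rot_cat.
Qed.

Definition crossed Y A := ~~ ((A \subset Y) || [disjoint A & Y]).
Definition uncrossed P Y := ~~ has (crossed Y) P.

Lemma crossedC Y A : crossed (~: Y) A = crossed Y A.
Proof.
rewrite /crossed -subsets_disjoint -setCS orbC; congr (~~ (_ || _)).
by rewrite setCS -(setCK Y) disjoints_subset setCK.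
Qed.

Lemma uncrossedC P Y : uncrossed P (~: Y) = uncrossed P Y.
Proof. by congr (~~ _); apply: eq_has => A; rewrite crossedC. Qed.

Lemma uncrossedP P Y A : uncrossed P Y -> A \in P ->
  (A \subset Y) || [disjoint A & Y].
Proof. by move=> /hasPn uY AP; have := uY _ AP; rewrite negbK. Qed.

Lemma interval_union_uncrossed P Y : list_flower P -> interval_union P Y ->
  uncrossed P Y.
Proof.
move=> fP [L1 [L2 [L3 [eP eY]]]].
wlog -> : Y eY / Y = U L2 => [H|].
  by case: eY => ->; rewrite ?uncrossedC; apply: H => //; left.
rewrite eP in fP *; have [d1 d2 d3 _] := list_flower3 fP.
apply/hasPn => A; rewrite negbK !mem_cat => /or3P[] /mem_bigcup_seq AL; apply/orP.
- by right; set_decide.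
- by left.
- by right; set_decide.
Qed.

Lemma uncrossed_perm P M Y : perm_eq P M -> uncrossed P Y = uncrossed M Y.
Proof. by move=> /perm_mem PM; congr (~~ _); apply: eq_has_r. Qed.

Lemma petal_disjoint P A B : list_flower P -> A \in P -> B \in P -> A != B ->
  [disjoint A & B].
Proof.
case=> _ dP _ _; elim: P dP => // C P IH /= /andP[/allP dC dP].
rewrite !inE => /predU1P[->|AP] /predU1P[->|BP]; rewrite ?eqxx//.
- by move=> _; apply: dC.
- by move=> _; rewrite disjoint_sym; apply: dC.
- exact: IH.
Qed.

Lemma petal_disjoint_bigcup P L A : list_flower P -> A \in P ->
  {subset L <= P} -> A \notin L -> [disjoint A & U L].
Proof.
move=> fP AP LP AL; rewrite disjoint_sym bigcup_seq_disjoint.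
apply/allP => B BL; apply: (petal_disjoint fP) => //; first exact: LP.
by apply: contraNneq AL => <-.
Qed.

Lemma uncrossed_bigcup P Y : U P = setT -> uncrossed P Y ->
  Y = U [seq A : {set E} <- P | A \subset Y].
Proof.
move=> cP uY; apply/eqP; rewrite eqEsubset bigcup_seq_sub.
rewrite (_ : all _ _ = true) ?andbT; last by apply/allP => A; rewrite mem_filter => /andP[].
apply/subsetP => x xY; have : x \in U P by rewrite cP inE.
rewrite !mem_bigcup_has => /hasP[A AP xA]; apply/hasP; exists A => //.
rewrite mem_filter AP andbT; case/orP: (uncrossedP uY AP) => //.
by move=> /disjoint_pointwise/(_ x); rewrite xA xY.
Qed.

(** The dichotomy of anemones and daisies: one k-separating union that is not an arc makes all
    unions k-separating. Those containing [C] are built from the pairs [C :|: B], and these from the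
    pair [C :|: A]. *)
Lemma alternating_union_all C A L1 L2 Y W :
  list_flower (C :: L1 ++ A :: L2) -> uncrossed (C :: L1 ++ A :: L2) Y ->
  ksep Y -> C \subset Y -> A \subset Y ->
  ~~ (U L1 \subset Y) -> ~~ (U L2 \subset Y) ->
  uncrossed (C :: L1 ++ A :: L2) W -> ksep W.
Proof.
set P := C :: _ => fP uY kY CY AY nL1 nL2.
have [/allP bP dP cP kP] := fP.
have ePC : P = [:: C] ++ L1 ++ A :: L2 by [].
have ePA : P = (C :: L1) ++ [:: A] ++ L2 by [].
have [d1 d2 d3 c] := list_flower3 (fP : list_flower ((C :: L1) ++ [:: A] ++ L2)).
have [d4 d5 d6 _] := list_flower3 (fP : list_flower ([:: C] ++ L1 ++ A :: L2)).
rewrite !bigcup_cons_seq ?big_nil ?setU0 in d1 d2 d3 d4 d5 d6 c.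
have bC : big C by apply: bP; rewrite mem_head.
have bA : big A by apply: bP; rewrite ePA !mem_cat mem_head !orbT.
have out L : {subset L <= P} -> ~~ (U L \subset Y) -> big (~: Y :&: U L).
  move=> LP; rewrite bigcup_seq_sub => /allPn[B BL nBY].
  apply: bigS (bP B (LP B BL)); rewrite subsetI mem_bigcup_seq// andbT.
  by have := uncrossedP uY (LP B BL); rewrite (negbTE nBY) disjoints_subset.
have L1P : {subset L1 <= P} by move=> B BL; rewrite ePC !mem_cat BL orbT.
have L2P : {subset L2 <= P} by move=> B BL; rewrite ePA !mem_cat BL !orbT.
have bo1 := out _ L1P nL1; have bo2 := out _ L2P nL2.
have bL1 : big (U L1) by apply: bigS bo1; apply: subsetIr.
have bL2 : big (U L2) by apply: bigS bo2; apply: subsetIr.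
have kL1 : ksep (U L1) by apply: (kP [:: C] L1 (A :: L2)).
have kL2 : ksep (U L2) by apply: (kP ((C :: L1) ++ [:: A]) L2 [::]); rewrite cats0 -catA.
(* The complement of [C :|: A] is put together from [~: Y], [U L1] and [U L2]; the overlaps are big
   thanks to the petals outside [Y]. *)
have kCA : ksep (C :|: A).
  have k1 : ksep (~: Y :|: U L1).
    apply: ksep_cupW; rewrite ?ksepC//.
    by apply: bigS bC; clear -CY; set_decide.
  rewrite -ksepC (_ : ~: _ = (~: Y :|: U L1) :|: U L2); last by clear -c d1 d2 d3 d4 d5 d6 CY AY; set_decide.
  apply: ksep_cupW => //.
    by apply: bigS bo2; set_decide.
  by apply: bigS bC; clear -CY d2; set_decide.
have split_mem B L : B \in L -> exists M1 M2, L = M1 ++ B :: M2.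
  by case/splitPr => M1 M2; exists M1, M2.
(* For [B] in [L1], join the arc from [B] to [A] to [C :|: A]; the complement consists of [L2] and
   the petals of [L1] before [B]. The arc of all petals after [B] completes this to the complement
   of [C :|: B]. The case of [L2] is the mirror image. *)
have kCB B : B \in L1 ++ A :: L2 -> ksep (C :|: B).
  have kCAC : ksep (~: (C :|: A)) by rewrite ksepC.
  have parts L M1 B' M2 : disjoint_petals L -> L = M1 ++ B' :: M2 ->
      [/\ U L = U M1 :|: (B' :|: U M2), [disjoint U M1 & B'],
          [disjoint U M1 & U M2] & [disjoint B' & U M2]].
    move=> dL eL; rewrite eL bigcup_cat_seq bigcup_cons_seq.
    rewrite eL -cat1s in dL; have [_ dM dMB] := disjoint_petals_cat dL.
    have [_ _ dBM] := disjoint_petals_cat dM.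
    rewrite bigcup_cat_seq bigcup_seq1_set in dMB.
    rewrite bigcup_seq1_set in dBM.
    by split=> //; clear -dMB; set_decide.
  have [_ dLs _] := disjoint_petals_cat (dP : disjoint_petals ([:: C] ++ L1 ++ A :: L2)).
  have [dL1 dAL2 _] := disjoint_petals_cat dLs.
  have [_ dL2 _] := disjoint_petals_cat (dAL2 : disjoint_petals ([:: A] ++ L2)).
  rewrite mem_cat inE => /or3P[/split_mem[M1 [M2 e]]|/eqP->//|/split_mem[M1 [M2 e]]].
    have k1 : ksep (B :|: (U M2 :|: A)).
      have := kP (C :: M1) (B :: M2 ++ [:: A]) L2; rewrite bigcup_cons_seq.
      rewrite bigcup_cat_seq bigcup_seq1_set; apply.
      by rewrite /P e /= -?catA /= -?catA.
    have k2 : ksep (U M2 :|: (A :|: U L2)).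
      have := kP (C :: M1 ++ [:: B]) (M2 ++ A :: L2) [::].
      rewrite bigcup_cat_seq bigcup_cons_seq; apply.
      by rewrite /P e /= cats0 -?catA /= -?catA.
    have [eU p1 p2 p3] := parts _ _ _ _ dL1 e.
    rewrite {}eU in d1 d2 d3 d4 d5 d6 c.
    have k3 : ksep ((C :|: A) :|: (B :|: (U M2 :|: A))).
      apply: ksep_cupW => //; first by apply: bigS bA; clear; set_decide.
      by apply: bigS bL2; clear -d2 d3 d5; set_decide.
    rewrite -ksepC (_ : ~: _ = ~: ((C :|: A) :|: (B :|: (U M2 :|: A))) :|:
      (U M2 :|: (A :|: U L2))); last by clear -p1 p2 p3 d1 d2 d3 d4 d5 d6 c; set_decide.
    apply: ksep_cupW; rewrite ?ksepC//.
      by apply: bigS bL2; clear -d2 d3 d5; set_decide.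
    by apply: bigS bC; clear; set_decide.
  have k1 : ksep (A :|: (U M1 :|: B)).
    have := kP (C :: L1) (A :: M1 ++ [:: B]) M2; rewrite bigcup_cons_seq.
    rewrite bigcup_cat_seq bigcup_seq1_set; apply.
    by rewrite /P e /= -?catA /= -?catA.
  have k2 : ksep (U L1 :|: (A :|: U M1)).
    have := kP [:: C] (L1 ++ A :: M1) (B :: M2).
    rewrite bigcup_cat_seq bigcup_cons_seq; apply.
    by rewrite /P e /= -?catA /= -?catA.
  have [eU p1 p2 p3] := parts _ _ _ _ dL2 e.
  rewrite {}eU in d1 d2 d3 d4 d5 d6 c.
  have k3 : ksep ((C :|: A) :|: (A :|: (U M1 :|: B))).
    apply: ksep_cupW => //; first by apply: bigS bA; clear; set_decide.
    by apply: bigS bL1; clear -d1 d2 d4; set_decide.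
  rewrite -ksepC (_ : ~: _ = ~: ((C :|: A) :|: (A :|: (U M1 :|: B))) :|:
    (U L1 :|: (A :|: U M1))); last by clear -p1 p2 p3 d1 d2 d3 d4 d5 d6 c; set_decide.
  apply: ksep_cupW; rewrite ?ksepC//.
    by apply: bigS bL1; clear -d1 d2 d4; set_decide.
  by apply: bigS bC; clear; set_decide.
have kCs s : {subset s <= L1 ++ A :: L2} -> ksep (C :|: U s).
  elim: s => [|B s IH] sL.
    rewrite big_nil setU0; have := kP [::] [:: C] _ erefl.
    by rewrite bigcup_seq1_set.
  have {}IH : ksep (C :|: U s) by apply: IH => D Ds; apply: sL; rewrite inE Ds orbT.
  have BL : B \in L1 ++ A :: L2 by apply: sL; rewrite mem_head.
  rewrite bigcup_cons_seq; have [Bs|Bs] := boolP (B \in s).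
    by have BU := mem_bigcup_seq Bs; rewrite (setUidPr BU).
  have sP : {subset s <= P} by move=> D Ds; rewrite inE sL ?orbT// inE Ds orbT.
  have dBs : [disjoint B & U s].
    by apply: (petal_disjoint_bigcup fP) => //; rewrite inE BL orbT.
  (* The two sets meet exactly in the big petal [C]. *)
  rewrite (_ : C :|: _ = (C :|: B) :|: (C :|: U s)); last by clear; set_decide.
  apply: ksep_cupW => //; first exact: kCB.
    by apply: bigS bC; clear; set_decide.
  rewrite (_ : ~: _ = ~: C); last by clear -dBs; set_decide.
  by apply: bigS bL1; clear -d4 d1; set_decide.
wlog CW : W / C \subset W => [H|] uW.
  have [CW|nCW] := boolP (C \subset W); first exact: H.
  rewrite -ksepC; apply: H; rewrite ?uncrossedC//.
  have := uncrossedP uW (mem_head _ _).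
  by rewrite (negbTE nCW) disjoints_subset.
rewrite (uncrossed_bigcup cP uW) /P /= CW bigcup_cons_seq; apply: kCs => B.
by rewrite mem_filter => /andP[].
Qed.

(** * Daisies, anemones and order *)

Lemma mem_upet P (I : {set 'I_(size P)}) x :
  reflect (exists2 i, i \in I & x \in petal P i) (x \in upet I).
Proof. exact: bigcupP. Qed.

Lemma list_flower_nth_disjoint P i j : list_flower P ->
  i < size P -> j < size P -> i != j -> [disjoint petal P i & petal P j].
Proof.
move=> [_ /(pairwiseP set0) dP _ _] iP jP.
by case: ltngtP => // lt _; [|rewrite disjoint_sym]; apply: dP.
Qed.

Lemma list_flower_nth_big P i : list_flower P -> i < size P -> big (petal P i).
Proof. by move=> [/allP bP _ _ _] iP; apply: bP; apply: mem_nth. Qed.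

Lemma petal_sub_upet P (I : {set 'I_(size P)}) (i : 'I_(size P)) :
  list_flower P -> (petal P i \subset upet I) = (i \in I).
Proof.
move=> fP; apply/idP/idP => [/subsetP iI|iI]; last exact: bigcup_sup.
have /set0Pn[x xi] := big_neq0 (list_flower_nth_big fP (ltn_ord i)).
have /mem_upet[j jI xj] := iI x xi.
have [<-//|ji] := eqVneq j i.
have := list_flower_nth_disjoint fP (ltn_ord j) (ltn_ord i) ji.
by move=> /disjoint_pointwise/(_ x); rewrite xi xj.
Qed.

Lemma upet_uncrossed P (I : {set 'I_(size P)}) :
  (forall i j, i < size P -> j < size P -> i != j ->
     [disjoint petal P i & petal P j]) ->
  uncrossed P (upet I).
Proof.
move=> dP; apply/hasPn => A /(nthP set0)[i iP <-]; rewrite negbK.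
have [iI|iI] := boolP (Ordinal iP \in I).
  by rewrite (bigcup_sup (Ordinal iP) iI).
apply/orP; right; apply: pointwise_disjoint => x; apply/andP => -[xi].
move=> /mem_upet[j jI xj].
have ji : nat_of_ord j != i.
  by apply: contraNneq iI => ji; rewrite (_ : Ordinal iP = j)//; apply: val_inj.
have := dP _ _ (ltn_ord j) iP ji.
by move=> /disjoint_pointwise/(_ x); rewrite xj /petal xi.
Qed.

Lemma uncrossed_upet P Y : U P = setT -> uncrossed P Y ->
  exists I : {set 'I_(size P)}, Y = upet I.
Proof.
move=> cP uY; exists [set i : 'I_(size P) | petal P i \subset Y].
apply/eqP; rewrite eqEsubset; apply/andP; split; last first.
  by apply/bigcupsP => i; rewrite inE.
apply/subsetP => x xY; have : x \in U P by rewrite cP inE.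
rewrite mem_bigcup_has => /(has_nthP set0)[i iP xi].
apply/mem_upet; exists (Ordinal iP) => //; rewrite inE.
case/orP: (uncrossedP uY (mem_nth set0 iP)) => // /disjoint_pointwise/(_ x).
by rewrite xi xY.
Qed.

Lemma flower_displaysE P Y : list_flower P ->
  flower_displays lam k P Y <-> ksep Y /\ uncrossed P Y.
Proof.
move=> fP; split=> [[kY [I eY]]|[kY uY]].
  split=> //; rewrite eY; apply: upet_uncrossed => i j.
  exact: list_flower_nth_disjoint.
by split=> //; apply: uncrossed_upet => //; case: fP.
Qed.

Lemma nth_rot_mod (T : Type) (x0 : T) (s : seq T) a t : a <= size s -> t < size s ->
  nth x0 (rot a s) t = nth x0 s ((a + t) %% size s).
Proof.
move=> an tn; rewrite nth_cat size_drop nth_drop; case: ltnP => ta.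
  by rewrite modn_small//; lia.
rewrite nth_take; last by lia.
by congr nth; rewrite (_ : a + t = (t - (size s - a)) + size s) ?modnDr ?modn_small//; lia.
Qed.

Lemma cyc_interval_take P (I : {set 'I_(size P)}) : cyc_interval I ->
  exists a b, upet I = U (take b (rot a P)).
Proof.
move=> [a [b [bP aI]]]; have n0 : 0 < size P by lia.
exists (a %% size P), b.+1; apply/setP => x; rewrite mem_bigcup_has.
have am : a %% size P <= size P by rewrite ltnW ?ltn_pmod.
apply/mem_upet/(has_nthP set0) => [[i /aI[t tb it] xi]|[t]].
  exists t; first by rewrite size_takel ?size_rot//; lia.
  by rewrite nth_take// nth_rot_mod ?modnDml -?it//; lia.
rewrite size_takel ?size_rot// => tb; rewrite nth_take// nth_rot_mod; [|lia|lia].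
rewrite modnDml => xt; exists (Ordinal (ltn_pmod (a + t) n0)) => //.
by apply/aI; exists t.
Qed.

Lemma cyc_interval_ksep P (I : {set 'I_(size P)}) : list_flower P ->
  cyc_interval I -> ksep (upet I).
Proof.
move=> fP /cyc_interval_take[a [b ->]].
have [_ _ _ kP] := list_flower_rot a fP.
by apply: (kP [::] _ (drop b (rot a P))); rewrite cat_take_drop.
Qed.

(** Start at an index of [I] whose predecessor is outside and follow [I] to its first gap. A later
    member would make [I] alternate, and [alternating_union_all] would make [W] k-separating. *)
Lemma ksep_cyc_interval P (I : {set 'I_(size P)}) W : list_flower P ->
  I != set0 -> ksep (upet I) -> uncrossed P W -> ~~ ksep W -> cyc_interval I.
Proof.
move=> fP /set0Pn[i1 i1I] kI uW nW.
set n := size P in I i1 i1I kI *; have n0 : 0 < n by apply: leq_ltn_trans (ltn_ord i1).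
have [->|/eqP IT] := eqVneq I setT.
  exists 0, n.-1; split; first by rewrite prednK.
  move=> i; rewrite inE; split=> // _; have i_n := ltn_ord i.
  by exists (nat_of_ord i); [lia|rewrite add0n modn_small].
have [i0 i0I] : exists i0, i0 \notin I.
  by apply/existsP; rewrite -negb_forall; apply: contra_notN IT => /forallP aI;
    apply/setP => i; rewrite aI inE.
pose f a t := Ordinal (ltn_pmod (a + t) n0) \in I.
have fE a a' t t' : a + t = a' + t' %[mod n] -> f a t = f a' t'.
  move=> e; rewrite /f.
  by have -> : Ordinal (ltn_pmod (a + t) n0) = Ordinal (ltn_pmod (a' + t') n0) by apply: ord_inj.
have ford (i : 'I_n) a t : i = (a + t) %% n :> nat -> f a t = (i \in I).
  by move=> e; rewrite /f; have -> : Ordinal (ltn_pmod (a + t) n0) = i by apply: ord_inj.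
have [a [an fa0 fan]] : exists a, [/\ a < n, f a 0 & ~~ f a n.-1].
  have [[a [fa0 fan]]|nex] := pselect (exists a, f a 0 /\ ~~ f a n.-1).
    exists (a %% n); rewrite ltn_pmod//; split=> //.
      by rewrite (fE _ a _ 0)// modnDml.
    by rewrite (fE _ a _ n.-1)// modnDml.
  (* Adding [n.-1] is stepping back by one modulo [n]. Without a starting index, membership would
     spread backwards from [i1] until it reaches [i0]. *)
  have down m : f (i1 + m * n.-1) 0.
    elim: m => [|m IH]; first by rewrite (ford i1)// addn0 mul0n addn0 modn_small.
    have : f (i1 + m * n.-1) n.-1.
      by apply/negPn/negP => nf; case: nex; exists (i1 + m * n.-1).
    by rewrite (fE _ (i1 + m.+1 * n.-1) _ 0)//; congr (_ %% _); rewrite mulSn; lia.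
  have := down (i1 + n - i0); rewrite (ford i0) ?(negbTE i0I)//.
  have i0n := ltn_ord i0; have i1n := ltn_ord i1.
  rewrite (_ : i1 + _ + 0 = (i1 + n - i0).-1 * n + i0); first by rewrite modnMDl modn_small.
  have m0 : 0 < i1 + n - i0 by lia.
  nia.
have exf : exists t, ~~ f a t by exists n.-1.
case: (ex_minnP exf) => t1 nft1 t1min.
have t10 : 0 < t1 by case: t1 nft1 {t1min} => //; rewrite fa0.
have t1n : t1 <= n.-1 by apply: t1min.
have below t : t < t1 -> f a t.
  by move=> tt1; apply/negPn/negP => /t1min; rewrite leqNgt tt1.
have pn i : nth set0 (rot a P) i = petal P ((a + i) %% n) \/ n <= i.
  have [ni|ni] := leqP n i; first by right.
  by left; rewrite nth_rot_mod// ltnW.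
have inY t : t < n -> (nth set0 (rot a P) t \subset upet I) = f a t.
  move=> tn; rewrite nth_rot_mod//; last by rewrite ltnW.
  exact: (petal_sub_upet I (Ordinal (ltn_pmod (a + t) n0)) fP).
have above t : t1 < t -> t < n -> ~~ f a t.
  move=> t1t tn; apply/negP => fat.
  have tn1 : t < n.-1.
    have : t != n.-1 by apply: contraNneq fan => <-.
    by clear -tn; lia.
  have sR : size (rot a P) = n by rewrite size_rot.
  have sT : size (take t (rot a P)) = t by rewrite size_takel ?sR// ltnW.
  have t1n' : t1 < n by apply: ltn_trans t1t tn.
  have n1n : n.-1 < n by rewrite prednK.
  have eR : rot a P = nth set0 (rot a P) 0 :: behead (take t (rot a P)) ++
      nth set0 (rot a P) t :: drop t.+1 (rot a P).
    rewrite -drop_nth ?sR// -{1}(cat_take_drop t (rot a P)).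
    case eT : (take t (rot a P)) sT => [|A L]; first by move=> t0; rewrite -t0 in t1t.
    have -> // : nth set0 (rot a P) 0 = A.
    by rewrite -(cat_take_drop t (rot a P)) eT.
  have pR : perm_eq (rot a P) P by rewrite perm_rot.
  have fR := list_flower_rot a fP.
  have uR : uncrossed (rot a P) (upet I).
    rewrite (uncrossed_perm _ pR) upet_uncrossed// => i j.
    exact: list_flower_nth_disjoint.
  have uWR : uncrossed (rot a P) W by rewrite (uncrossed_perm _ pR).
  rewrite eR in fR uR uWR.
  case/negP: nW; apply: (alternating_union_all fR uR) => //.
  - by rewrite inY.
  - by rewrite inY.
  - rewrite bigcup_seq_sub; apply/allPn; exists (nth set0 (rot a P) t1).
      rewrite -(nth_take set0 t1t) -{1}(prednK t10) -nth_behead.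
      by apply: mem_nth; rewrite size_behead sT; clear -t1t t10; lia.
    by rewrite inY.
  - rewrite bigcup_seq_sub; apply/allPn; exists (nth set0 (rot a P) n.-1).
      rewrite -(subnKC tn1) -nth_drop; apply: mem_nth.
      by rewrite size_drop sR; clear -tn1; lia.
    by rewrite inY.
have b_n : t1.-1 < n by clear -t1n n0; lia.
exists a, t1.-1; split=> //.
move=> i; split=> [iI|[t tt1 it]]; last first.
  by rewrite -(ford i a t it) below//; clear -tt1 t10; lia.
have i_n := ltn_ord i.
have it : i = (a + (i + n - a) %% n) %% n :> nat.
  rewrite modnDmr (_ : a + (i + n - a) = i + n); last by clear -an; lia.
  by rewrite modnDr modn_small.
exists ((i + n - a) %% n) => //; rewrite leqNgt; apply/negP => lt.
have : f a ((i + n - a) %% n) by rewrite (ford i).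
apply/negP; have := ltn_pmod (i + n - a) n0.
move: lt; rewrite prednK// leq_eqVlt => /predU1P[<- _//|lt ltn].
exact: above.
Qed.

Lemma rot_pair P i : i < size P -> 1 < size P ->
  rot i P = [:: petal P i, petal P ((i + 1) %% size P) & drop 2 (rot i P)].
Proof.
move=> iP P2; have := nth_rot_mod set0 (ltnW iP) P2.
have := nth_rot_mod set0 (ltnW iP) (ltnW P2).
rewrite addn0 modn_small// /petal => <- <-.
have : 1 < size (rot i P) by rewrite size_rot.
by case: (rot i P) => [|A [|B L]] //= _; rewrite drop0.
Qed.

Lemma list_flower_flower P : list_flower P -> 0 < size P -> flower lam k Tg P.
Proof.
move=> fP P0; split=> //; split.
  by move=> i j; apply: list_flower_nth_disjoint.
have [/allP bP _ cP kP] := fP; split.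
  by rewrite -cP (big_nth set0) big_mkord.
move=> i iP; rewrite big_strong ?list_flower_nth_big//=.
have ki : ksep (petal P i).
  have := kP (take i P) [:: petal P i] (drop i.+1 P).
  by rewrite bigcup_seq1_set; apply; rewrite /petal /= -drop_nth// cat_take_drop.
rewrite ki; have [P1|P1] := leqP (size P) 1.
  have eP1 : size P = 1 by apply/eqP; rewrite eqn_leq P1.
  by rewrite eP1 modn1 (_ : 0 = i) ?setUid//; move: iP; rewrite eP1; case: (i).
have [_ _ _ kR] := list_flower_rot i fP.
by have := kR [::] _ _ (rot_pair iP P1 : _ = [::] ++ [:: _; _] ++ _);
  rewrite !big_cons big_nil setU0.
Qed.

Lemma list_flower_anemone P : list_flower P -> 0 < size P ->
  (forall W, uncrossed P W -> ksep W) -> anemone lam k Tg P.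
Proof.
move=> fP P0 kP; split; first exact: list_flower_flower.
move=> I _; apply: kP; apply: upet_uncrossed => i j.
exact: list_flower_nth_disjoint.
Qed.

Lemma list_flower_daisy P W : list_flower P -> 0 < size P ->
  uncrossed P W -> ~~ ksep W -> daisy lam k Tg P.
Proof.
move=> fP P0 uW nW; split; first exact: list_flower_flower.
move=> I I0; split=> [kI|]; last exact: cyc_interval_ksep.
exact: ksep_cyc_interval kI uW nW.
Qed.

(** Used to make any two petals of an anemone consecutive, so that looseness need only be excluded
    at the head of a list. *)
Lemma list_flower_perm P Q : list_flower P ->
  (forall W, uncrossed P W -> ksep W) -> perm_eq P Q -> list_flower Q.
Proof.
move=> fP kP PQ; have [bP dP cP _] := fP; split.
- by rewrite -(eq_all_r (perm_mem PQ)).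
- have uP : uniq P.
    rewrite uniq_pairwise; apply: sub_in_pairwise bP dP => A B bA _ dAB.
    apply: contraNneq (big_neq0 bA) => eAB.
    by rewrite -eAB -setI_eq0 setIid in dAB.
  have := uP; rewrite (perm_uniq PQ) uniq_pairwise.
  apply: (@sub_in_pairwise _ [in Q] _ _ _ Q (allss Q)) => A B.
  move=> AQ BQ; apply: petal_disjoint fP _ _; rewrite (perm_mem PQ); [exact: AQ|exact: BQ].
- by rewrite -cP; apply: perm_big; rewrite perm_sym.
move=> L1 L2 L3 eQ; apply: kP; apply/hasPn => A AP; rewrite negbK.
have [AL|AL] := boolP (A \in L2); first by rewrite mem_bigcup_seq.
apply/orP; right; apply: (petal_disjoint_bigcup fP) => // B BL.
by rewrite (perm_mem PQ) eQ !mem_cat BL orbT.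
Qed.

(** Both sides of a (k,S)-separation are nonempty, so two petals leave only one choice up to
    complement. *)
Lemma two_petal_displays Q X Y : flower lam k Tg Q -> size Q <= 2 ->
  kS X -> kS Y -> flower_displays lam k Q X -> flower_displays lam k Q Y ->
  tequiv X Y.
Proof.
move=> [Q0 [dQ [cQ _]]] Q2 kX kY [_ [I eX]] [_ [J eY]].
have uX : uncrossed Q X by rewrite eX upet_uncrossed.
have uY : uncrossed Q Y by rewrite eY upet_uncrossed.
have {}cQ : U Q = setT by rewrite -cQ (big_nth set0) big_mkord.
clear I J eX eY.
have proper Z : kS Z -> Z != set0 /\ Z != setT.
  move=> kZ; rewrite big_neq0 ?kS_big//; split=> //.
  apply: contraTneq (kS_big_compl kZ) => ->.
  by rewrite setCT negbK small0.
case: Q Q0 Q2 dQ uX uY cQ => [|A [|B [|//]]] //= _ _ dQ uX uY.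
  rewrite bigcup_seq1_set => cA.
  have [/negbTE X0 /negbTE XT] := proper X kX; have := uncrossedP uX (mem_head _ _).
  by rewrite cA subTset XT disjoint_sym disjoints_subset setCT subset0 X0.
have {}dQ : [disjoint A & B] by apply: (dQ 0 1).
rewrite !big_cons big_nil setU0 => cQ.
have one Z : kS Z -> uncrossed [:: A; B] Z -> Z = A \/ Z = ~: A.
  move=> kZ uZ; have [Z0 ZT] := proper Z kZ.
  have BQ : B \in [:: A; B] by rewrite !inE eqxx orbT.
  have := uncrossedP uZ (mem_head _ _); have := uncrossedP uZ BQ.
  move=> /orP[BZ|BZ] /orP[AZ|AZ].
  - by case/eqP: ZT; set_decide.
  - by right; set_decide.
  - by left; set_decide.
  - by case/eqP: Z0; set_decide.
suff [->|->] : Y = X \/ Y = ~: X; [exact: tequiv_refl|exact: tequiv_compl|].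
by case: (one X kX uX) => ->; case: (one Y kY uY) => ->; rewrite ?setCK; tauto.
Qed.

(** Every equivalent flower has to display both classes, which takes more than two petals. *)
Lemma list_flower_Sorder P X Y : list_flower P ->
  kS X -> uncrossed P X -> kS Y -> uncrossed P Y -> ~~ tequiv X Y ->
  0 < size P -> Sorder_ge3 lam k Tg S P.
Proof.
move=> fP kX uX kY uY nt P0; pose fl := flower_equiv lam k Tg S P.
pose a n := `[< exists2 Q, flower lam k Tg Q /\ fl Q & size Q = n >].
have refl : fl P by split=> Z kZ dZ; exists Z => //; apply: tequiv_refl.
have a0 : exists n, a n.
  by exists (size P); apply/asboolP; exists P => //; split=> //; apply: list_flower_flower.
have [n /asboolP[Q [fQ eQ] sQ] nmin] := ex_minnP a0; exists n; split.
  split; first by exists Q.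
  by move=> R fR eR; apply: nmin; apply/asboolP; exists R.
rewrite leqNgt; apply/negP => n2; rewrite -sQ ltnS in n2.
have dX : flower_displays lam k P X by apply/flower_displaysE => //; split=> //; apply: kS_ksep.
have dY : flower_displays lam k P Y by apply/flower_displaysE => //; split=> //; apply: kS_ksep.
have [X' [kX' dX'] tX] := proj1 eQ X kX dX.
have [Y' [kY' dY'] tY] := proj1 eQ Y kY dY.
case/negP: nt; apply: tequiv_trans tX _; rewrite tequiv_sym.
apply: tequiv_trans tY _; exact: two_petal_displays fQ n2 _ _ _ _.
Qed.

Section Tightness.
Variable P : seq {set E}.
Hypothesis fP : list_flower P.

Lemma no_loose_daisyP :
  (forall A B L, perm_eq P [:: A, B & L] -> list_flower [:: A, B & L] ->
     ~~ (A \subset fcl B) && ~~ (B \subset fcl A)) ->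
  no_loose_daisy lam k Tg P.
Proof.
move=> tight P2.
have adj a : a < size P -> ~~ (petal P a \subset fcl (petal P ((a + 1) %% size P)))
    && ~~ (petal P ((a + 1) %% size P) \subset fcl (petal P a)).
  move=> aP; have fR := list_flower_rot a fP.
  have pR : perm_eq P (rot a P) by rewrite perm_sym perm_rot.
  by rewrite (rot_pair aP P2) in fR pR; apply: tight pR fR.
move=> i j iP jP _ /orP[/eqP->|/eqP->]; first by have /andP[] := adj i iP.
by have /andP[] := adj j jP.
Qed.

Lemma no_loose_anemoneP : (forall W, uncrossed P W -> ksep W) ->
  (forall A B L, perm_eq P [:: A, B & L] -> list_flower [:: A, B & L] ->
     ~~ (A \subset fcl B) && ~~ (B \subset fcl A)) ->
  no_loose_anemone lam k Tg P.
Proof.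
move=> kP tight P2 i j iP jP ji.
have AP : petal P i \in P by apply: mem_nth.
have BP : petal P j \in P by apply: mem_nth.
have AB : petal P j != petal P i.
  have dAB := list_flower_nth_disjoint fP jP iP ji.
  apply: contraNneq (big_neq0 (list_flower_nth_big fP iP)) => e.
  by rewrite e -setI_eq0 setIid in dAB.
have pA := perm_to_rem AP.
have BR : petal P j \in rem (petal P i) P.
  by move: BP; rewrite (perm_mem pA) inE (negbTE AB).
have pAB := perm_trans pA (_ : perm_eq _ (petal P i :: petal P j :: rem (petal P j) (rem (petal P i) P))).
have {}pAB := pAB (etrans (perm_cons _ _ _) (perm_to_rem BR)).
by have /andP[] := tight _ _ _ pAB (list_flower_perm fP kP pAB).
Qed.

End Tightness.

(** * Every separation inside a bag conforms with a maximal flower *)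

Section Conformity.
Variables (N : {set E}) (undisplayed : {set E} -> Prop) (m : nat).
Hypothesis N_big : N = set0 \/ big N.
Hypothesis undisplayed_tequiv :
  forall X Y, tequiv X Y -> undisplayed X -> undisplayed Y.

Definition inner_kS Z := [/\ kS Z, undisplayed Z & [disjoint Z & N]].
Hypothesis closure_le_m : forall Z, inner_kS Z -> #|fcl Z| <= m.

(** [N] is removed from the petal because the bags that the petals become in the refined tree
    exclude it. *)
Definition conforming P Z : Prop :=
  (exists2 Y, uncrossed P Y & tequiv Z Y) \/
  (exists Y A, [/\ A \in P, Y \subset A :\: N & tequiv Z Y]).

Definition admissible P : Prop :=
  [/\ list_flower P, has (fun A => N \subset A) P &
      exists X, [/\ inner_kS X, #|fcl X| = m & interval_union P X]].

Definition represents P Y : Prop :=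
  kS Y /\ exists2 X, interval_union P X & tequiv Y X.

Definition maximal P : Prop :=
  forall P', admissible P' -> (forall Y, represents P Y -> represents P' Y) ->
  size P' <= size P /\ (forall Y, represents P' Y -> represents P Y).

(** Cutting a petal along such a [Z] leaves [N] inside a single petal. *)
Definition respects Z := (N \subset Z) || [disjoint N & Z].

Definition min_crossing P Z : Prop :=
  forall Z', tequiv Z Z' -> respects Z' ->
  count (crossed Z) P <= count (crossed Z') P.

(** A counterexample to conformity with the fewest crossings in its class. The notion is invariant
    under complement and rotation, which allows any petal to be put first and the two sides of [Z]
    to be exchanged. *)
Definition stuck P Z : Prop :=
  [/\ admissible P /\ maximal P, kS Z /\ undisplayed Z, respects Z,
      min_crossing P Z & ~ conforming P Z].

Lemma respectsC Z : respects (~: Z) = respects Z.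
Proof. by rewrite /respects !disjoints_subset setCK orbC. Qed.

Lemma stuckC P Z : stuck P Z -> stuck P (~: Z).
Proof.
case=> aP [kZ uZ] rZ mZ nZ; have tZ := tequiv_compl kZ.
split; rewrite ?respectsC//.
- by rewrite kSC; split=> //; apply: undisplayed_tequiv uZ.
- move=> Z' tZ' rZ'; rewrite (eq_count (crossedC Z)).
  by apply: mZ rZ'; apply: tequiv_trans tZ'.
- case=> [[Y uY tY]|[Y [A [AP YA tY]]]]; apply: nZ.
    by left; exists Y => //; apply: tequiv_trans tY.
  by right; exists Y, A; split=> //; apply: tequiv_trans tY.
Qed.

Lemma admissible_rot n P : admissible P -> admissible (rot n P).
Proof.
case=> fP hP [X [iX cX pX]]; split.
- exact: list_flower_rot.
- by rewrite (eq_has_r (mem_rot n P)).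
- by exists X; split=> //; apply: interval_union_rot.
Qed.

Lemma interval_union_rotE n P Y : list_flower P ->
  interval_union (rot n P) Y <-> interval_union P Y.
Proof.
move=> fP; split; last exact: interval_union_rot.
move=> /(interval_union_rot (size (rot n P) - n) (list_flower_rot n fP)).
by rewrite -/(rotr n _) rotK.
Qed.

Lemma stuck_rot n P Z : stuck P Z -> stuck (rot n P) Z.
Proof.
case=> [[aP mP] kuZ rZ mZ nZ]; have [fP _ _] := aP.
have repE Y : represents (rot n P) Y <-> represents P Y.
  split=> -[kY [X iX tX]]; split=> //; exists X => //.
    by apply/(interval_union_rotE n).
  exact/(interval_union_rotE n).
have pP : perm_eq (rot n P) P by rewrite perm_rot.
split=> //.
- split; first exact: admissible_rot.
  move=> P' aP' lP'; rewrite size_rot.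
  have [|s sP] := mP P' aP'; first by move=> Y /repE/lP'.
  by split=> // Y /sP/repE.
- move=> Z' tZ' rZ'; have := mZ Z' tZ' rZ'.
  by rewrite !(permP pP).
- case=> [[Y uY tY]|[Y [A [AP YA tY]]]]; apply: nZ.
    by left; exists Y => //; rewrite -(uncrossed_perm _ pP).
  by right; exists Y, A; split=> //; rewrite -(mem_rot n).
Qed.

(** * Separations that cross a maximal flower minimally *)

Lemma count_ltn_in (a b : pred {set E}) L A :
  {in L, forall B, a B -> b B} -> A \in L -> b A -> ~~ a A ->
  count a L < count b L.
Proof.
move=> ab AL bA naA.
have -> : count a L = count a (filter b L).
  rewrite count_filter; apply: eq_in_count => B BL /=.
  by case aB: (a B) => //=; rewrite (ab B BL aB).
rewrite -(size_filter b) ltn_neqAle count_size andbT -all_count.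
by apply/allPn; exists A; rewrite // mem_filter bA.
Qed.

(* Otherwise absorbing [L] would lower the number of crossed petals. *)
Lemma stuck_absorb P Z L A : stuck P Z -> {subset L <= P} ->
  small (U L :\: Z) -> ksep (Z :|: U L) -> A \in L -> ~~ crossed Z A.
Proof.
case=> [[[fP hP _] _] [kZ uZ] rZ mZ _] LP sL kZL AL; apply/negP => cA.
have [kZ' sc] : kS (Z :|: U L) /\ same_closures (Z :|: U L) Z.
  rewrite (_ : Z :|: U L = Z :|: (U L :\: Z)) in kZL *; last by set_decide.
  exact: kS_addsmall.
have rZ' : respects (Z :|: U L).
  have [C CP NC] := hasP hP; apply/orP.
  have [CL|CL] := boolP (C \in L).
    by have CU := mem_bigcup_seq CL; left; set_decide.
  have dC := petal_disjoint_bigcup fP CP LP CL.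
  by case/orP: rZ => NZ; [left|right]; set_decide.
have := mZ _ _ rZ'; rewrite leqNgt => /(_ _)/negP; apply.
  by apply: same_closures_tequiv; rewrite // same_closures_sym.
apply: (@count_ltn_in _ _ _ A) => //; last 2 first.
- exact: LP.
- by rewrite /crossed negbK (subset_trans (mem_bigcup_seq AL)) ?subsetUr.
move=> C CP; apply: contraTT; rewrite /crossed !negbK => cC; apply/orP.
have [CL|CL] := boolP (C \in L).
  by left; rewrite (subset_trans (mem_bigcup_seq CL)) ?subsetUr.
have dC := petal_disjoint_bigcup fP CP LP CL.
by case/orP: cC => NZ; [left|right]; set_decide.
Qed.

(** Uncrossing makes [Z :|: U L2] k-separating, so no petal of [L2] is crossed. A petal disjoint
    from [Z] would be a big subset of the small remainder. *)
Lemma stuck_interval P Z L1 L2 L3 : stuck P Z -> P = L1 ++ L2 ++ L3 ->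
  big (U L2 :&: Z) -> small (U L2 :\: Z) -> U L2 \subset Z.
Proof.
move=> sPZ eP bL sL; have [[[fP _ _] _] [kZ _] _ _ _] := sPZ.
have L2P : {subset L2 <= P}.
  by move=> A AL; rewrite eP !mem_cat AL orbT.
have [/allP bP _ _ kP] := fP.
rewrite bigcup_seq_sub; apply/allP => A AL.
have : ~~ crossed Z A.
  apply: (stuck_absorb sPZ L2P) => //.
  apply: ksep_cupW; rewrite ?(kS_ksep kZ) ?(kP L1 L2 L3)//; first by rewrite setIC.
  by apply: bigS (kS_big_compl kZ); set_decide.
rewrite negbK => /orP[//|dAZ].
have := bP _ (L2P _ AL); rewrite (smallS _ sL)//.
by have AU := mem_bigcup_seq AL; set_decide.
Qed.

(** Otherwise [Z] is equivalent to [Z :&: A], nested in a petal. If this set avoids [N], it conforms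
    at once; if it contains [N], the choice of a largest closure decides. *)
Lemma stuck_nested A L Z : stuck (A :: L) Z -> big (A :&: Z) -> big (A :\: Z) ->
  big (Z :\: A).
Proof.
move=> sPZ b1 b2; apply/negP => s1.
have [[[fP hP [X [[kX uX dX] cX iX]]] _] [kZ uZ] rZ _ nc] := sPZ.
have kA : ksep A by case: fP => _ _ _ /(_ [::] [:: A] L erefl); rewrite big_seq1.
have uncX := interval_union_uncrossed fP iX.
have AX := uncrossedP uncX (mem_head _ _).
(* Were both remainders outside [A] small, [Z] would cut a (k,S)-separation disjoint from [A] into
   two small parts. *)
have [s2|b3] := boolP (small (~: Z :\: A)).
  have [X' [kX' dX']] : exists X', kS X' /\ [disjoint A & X'].
    case/orP: AX => AX; last by exists X.
    by exists (~: X); rewrite kSC; split=> //; set_decide.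
  apply: (kS_split_big kX' (kS_ksep kZ)).
    by apply: smallS s1; set_decide.
  by apply: smallS s2; set_decide.
have kZA : ksep (Z :\: (Z :\: A)).
  rewrite (_ : _ :\: _ = Z :&: A); last by set_decide.
  apply: ksep_capW; rewrite ?(kS_ksep kZ)//.
    by apply: bigS b1; set_decide.
  by apply: bigS b3; set_decide.
have [kZ' sc] := kS_delsmall kZ s1 kZA.
have eZA : Z :\: (Z :\: A) = Z :&: A by set_decide.
rewrite {}eZA in kZA kZ' sc.
have tZ : tequiv Z (Z :&: A).
  by apply: same_closures_tequiv; rewrite // same_closures_sym.
apply: nc; have [dN|ndN] := boolP [disjoint N & Z :&: A].
  right; exists (Z :&: A), A; split=> //; first exact: mem_head.
  by set_decide.
have NA : N \subset A.
  have /hasP[C CP NC] := hP; have [<-//|CA] := eqVneq C A.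
  have dCA := petal_disjoint fP CP (mem_head _ _) CA.
  by case/negP: ndN; set_decide.
have NZ : N \subset Z.
  by case/orP: rZ => // dNZ; case/negP: ndN; set_decide.
have iZ : inner_kS (~: (Z :&: A)).
  split; first by rewrite kSC.
    apply: undisplayed_tequiv uZ.
    by apply: tequiv_trans tZ _; apply: tequiv_compl.
  by set_decide.
have {}AX : [disjoint A & X].
  case/orP: AX => // AX.
  by case/negP: ndN; set_decide.
(* [Z] is equivalent to [X], as no inner set has a larger closure than [X]. *)
have XZ : X \subset ~: (Z :&: A) by set_decide.
have fXZ : fcl X \subset fcl (~: (Z :&: A)).
  by apply: fcl_mono; apply: subset_trans XZ (fcl_sub _).
have {fXZ}fE : fcl X = fcl (~: (Z :&: A)).
  by apply/eqP; rewrite eqEcard fXZ cX closure_le_m.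
have [kY sY] : kS (~: (Z :&: A)) /\ same_closures (~: (Z :&: A)) X.
  by apply: kS_between; rewrite ?ksepC// fE fcl_sub.
left; exists X => //; apply: tequiv_trans tZ _.
apply: tequiv_trans (tequiv_compl kZ') _.
exact: same_closures_tequiv.
Qed.

Lemma cat_eq_cat (T : Type) (s1 s2 t1 t2 : seq T) : s1 ++ s2 = t1 ++ t2 ->
  (exists2 r, s1 = t1 ++ r & t2 = r ++ s2) \/
  (exists2 r, t1 = s1 ++ r & s2 = r ++ t2).
Proof.
elim: s1 t1 => [|x s1 IH] [|y t1] /= e.
- by left; exists [::].
- by right; exists (y :: t1).
- by left; exists (x :: s1).
- case: e => -> /IH[[r -> ->]|[r -> ->]]; first by left; exists r.
  by right; exists r.
Qed.

(* [Z] separates [A] so that [A :&: Z] lies next to [L1] and [A :\: Z] lies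
   cyclically next to [L2]. *)
Lemma list_flower_split A L1 L2 Z : list_flower (A :: L1 ++ L2) -> kS Z ->
  big (A :&: Z) -> big (A :\: Z) -> big (U L1 :&: Z) -> big (U L2 :\: Z) ->
  list_flower ((A :\: Z) :: (A :&: Z) :: L1 ++ L2).
Proof.
move=> fP kZ bAZ bAZC bL1 bL2; have [bP dP cP kP] := fP.
have [dA1 dA2 d12 c] := list_flower3 (fP : list_flower ([:: A] ++ L1 ++ L2)).
rewrite bigcup_seq1_set in dA1 dA2 c.
have kA : ksep A by have := kP [::] [:: A] _ erefl; rewrite bigcup_seq1_set.
have kL1 : ksep (U L1) by apply: (kP [:: A] L1 L2).
have kL2 : ksep (U L2) by apply: (kP (A :: L1) L2 [::]); rewrite /= cats0.
have kZ1 : ksep (Z :|: U L1).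
  apply: ksep_cupW; rewrite ?(kS_ksep kZ)//; first by rewrite setIC.
  by apply: bigS (kS_big_compl kZ); set_decide.
have kZ2 : ksep ((A :&: Z) :|: U L1).
  rewrite (_ : _ :|: _ = (Z :|: U L1) :\: U L2); last by set_decide.
  apply: ksep_diffW => //; first by apply: bigS bL2; set_decide.
  by apply: bigS bAZ; set_decide.
have kAD : ksep (A :\: Z).
  rewrite (_ : A :\: Z = A :\: ((A :&: Z) :|: U L1)); last by set_decide.
  apply: ksep_diffW => //; first by apply: bigS bL1; set_decide.
  by apply: bigS bAZ; set_decide.
(* Apart from [A :\: Z] alone, the new intervals are [A :&: Z] followed by a prefix. A prefix within
   [L1] is reached by an intersection, a longer one by a union. *)
have kprefix M M' : L1 ++ L2 = M ++ M' -> ksep ((A :&: Z) :|: U M).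
  case/cat_eq_cat=> [[R e1 e2]|[R e1 e2]].
    have kAM : ksep (A :|: U M).
      rewrite -bigcup_cons_seq; apply: (kP [::] (A :: M) (R ++ L2)).
      by rewrite e1 /= -catA.
    have MU : U M \subset U L1 by rewrite e1 bigcup_cat_seq subsetUl.
    rewrite (_ : _ :|: _ = (A :&: Z :|: U L1) :&: (A :|: U M)); last by set_decide.
    apply: ksep_capW => //; first by apply: bigS bAZ; set_decide.
    by apply: bigS bL2; set_decide.
  have k1R : ksep (U L1 :|: U R).
    rewrite -bigcup_cat_seq; apply: (kP [:: A] (L1 ++ R) M').
    by rewrite e2 /= -catA.
  have RU : U R \subset U L2 by rewrite e2 bigcup_cat_seq subsetUl.
  rewrite e1 bigcup_cat_seq.
  rewrite (_ : _ :|: _ = (A :&: Z :|: U L1) :|: (U L1 :|: U R)); last by set_decide.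
  apply: ksep_cupW => //; first by apply: bigS bL1; set_decide.
  by apply: bigS bAZC; set_decide.
split.
- by move: bP => /= /andP[_ ->]; rewrite bAZ bAZC.
- move: dP => /= /andP[/allP dA ->]; rewrite andbT; apply/andP; split.
    apply/andP; split; first by set_decide.
    by apply/allP => C /dA dAC; set_decide.
  by apply/allP => C /dA dAC; set_decide.
- by rewrite -cP !bigcup_cons_seq; set_decide.
move=> [|B1 [|B2 M1]] M2 M3 /=.
- case: M2 => [_|B1 [[<- e]|B2 M2 [<- <- e]]]; first by rewrite big_nil (ksep0 kA).
    by rewrite bigcup_seq1_set.
  rewrite !bigcup_cons_seq (_ : _ :|: _ = A :|: U M2); last by set_decide.
  by rewrite -bigcup_cons_seq; apply: (kP [::] (A :: M2) M3); rewrite e.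
- case: M2 => [_|B2 M2 [_ <- /kprefix]]; first by rewrite big_nil (ksep0 kA).
  by rewrite bigcup_cons_seq.
- by move=> [_ _ e]; apply: (kP (A :: M1) M2 M3); rewrite e.
Qed.

(** The split flower represents whatever the old one does, with one petal more, and [N] stays in one
    petal because [Z] respects it. *)
Lemma stuck_unsplittable A L1 L2 Z : stuck (A :: L1 ++ L2) Z ->
  big (A :&: Z) -> big (A :\: Z) -> big (U L1 :&: Z) -> big (U L2 :\: Z) -> False.
Proof.
move=> [[[fP hP [X [iX cX pX]]] mP] [kZ uZ] rZ _ _] b1 b2 b3 b4.
have fP' := list_flower_split fP kZ b1 b2 b3 b4.
have refine Y : interval_union (A :: L1 ++ L2) Y ->
    interval_union ((A :\: Z) :: (A :&: Z) :: L1 ++ L2) Y.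
  have eA : A = (A :\: Z) :|: (A :&: Z) by set_decide.
  move=> [[|B M1] [M2 [M3 [/= e eY]]]]; last first.
    case: e => _ e; exists [:: A :\: Z, A :&: Z & M1], M2, M3.
    by rewrite e.
  case: M2 e eY => [_|B M2 [<- e]] eY; first by exists [::], [::], [:: A :\: Z, A :&: Z & L1 ++ L2].
  exists [::], [:: A :\: Z, A :&: Z & M2], M3; rewrite e; split=> //.
  by rewrite !bigcup_cons_seq setUA -eA -bigcup_cons_seq.
have [] := mP ((A :\: Z) :: (A :&: Z) :: L1 ++ L2).
- split=> //; last by exists X; split=> //; apply: refine.
  move: hP => /=; case/orP=> [NA|->]; last by rewrite !orbT.
  case/orP: rZ => NZ; apply/orP; [right; apply/orP; left|left]; set_decide.
- by move=> Y [kY [X' /refine iX' tY]]; split=> //; exists X'.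
- by rewrite /= ltnn.
Qed.

(** The two small pieces of [Y] are absorbed in turn. After the first the set is
    [(X :|: Z) :&: (X :|: Y)], and [R] is the big set outside the union that uncrossing requires. *)
Lemma kS_absorb X Y Z R : kS X -> kS Z -> big (X :&: Z) ->
  small (Y :&: Z) -> small (Y :\: Z) -> ksep (X :|: Y) ->
  big R -> [disjoint R & X :|: Y :|: Z] ->
  kS (X :|: Y) /\ same_closures (X :|: Y) X.
Proof.
move=> kX kZ bXZ s1 s2 kXY bR dR.
have kXZ : ksep (X :|: Z).
  apply: ksep_cupW; rewrite ?(kS_ksep kX) ?(kS_ksep kZ)//.
  by apply: bigS (kS_big_compl kZ); set_decide.
have [|k1 c1] := kS_addsmall kX s1.
  rewrite (_ : _ :|: _ = (X :|: Z) :&: (X :|: Y)); last by set_decide.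
  apply: ksep_capW => //; first by apply: bigS bXZ; set_decide.
  by apply: bigS bR; set_decide.
have e : (X :|: Y :&: Z) :|: (Y :\: Z) = X :|: Y by set_decide.
have [|k2 c2] := kS_addsmall k1 s2; first by rewrite e.
by rewrite e in k2 c2; split=> //; apply: same_closures_trans c2 c1.
Qed.

Lemma stuck_complement A L Z : stuck (A :: L) Z ->
  big (A :&: Z) -> big (A :\: Z) -> big (U L :&: Z) /\ big (U L :\: Z).
Proof.
move=> sPZ b1 b2; have [[[fP _ _] _] _ _ _ _] := sPZ.
have := list_flower3 (fP : list_flower ([::] ++ [:: A] ++ L)).
rewrite bigcup_seq1_set big_nil => -[_ _ d c].
split; first by apply: bigS (stuck_nested sPZ b1 b2); set_decide.
have eA : A :\: ~: Z = A :&: Z by set_decide.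
have := stuck_nested (stuckC sPZ); rewrite -setDE eA => /(_ b2 b1).
by apply: bigS; set_decide.
Qed.

(** Otherwise the interval lies in [Z]. A big part of [L1] or [L3] outside [Z] would allow [A] to be
    split, so all but a small part of the complement of [A] is in [Z], against
    [stuck_complement]. *)
Lemma stuck_interval_not_inside A L1 L2 L3 Z : stuck (A :: L1 ++ L2 ++ L3) Z ->
  big (A :&: Z) -> big (A :\: Z) -> big (U L2 :&: Z) -> big (U L2 :\: Z).
Proof.
move=> sPZ b1 b2 b3; apply/negP => s3.
have L2Z : U L2 \subset Z.
  exact: (@stuck_interval _ _ (A :: L1) L2 L3 sPZ).
have [_ /negP[]] := stuck_complement sPZ b1 b2.
have s1 : small (U L1 :\: Z).
  apply/negPn/negP => bL1; have := stuck_unsplittable (stuckC sPZ).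
  rewrite -!setDE (_ : A :\: ~: Z = A :&: Z); last by set_decide.
  apply=> //; apply: bigS b3; rewrite bigcup_cat_seq.
  set_decide.
have L12Z : U (L1 ++ L2) \subset Z.
  apply: (@stuck_interval _ _ [:: A] (L1 ++ L2) L3 sPZ).
  - by rewrite /= -catA.
  - by apply: bigS b3; rewrite bigcup_cat_seq; set_decide.
  - by apply: smallS s1; rewrite bigcup_cat_seq; set_decide.
have s2 : small (U L3 :\: Z).
  apply/negPn/negP => bL3; rewrite catA in sPZ.
  apply: (stuck_unsplittable sPZ) => //; apply: bigS b3.
  by rewrite bigcup_cat_seq; set_decide.
apply: smallS s2; rewrite catA bigcup_cat_seq.
by set_decide.
Qed.

Lemma stuck_kS_interval A L1 L2 L3 Z : stuck (A :: L1 ++ L2 ++ L3) Z ->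
  big (A :&: Z) -> big (A :\: Z) -> kS (U L2) ->
  big (U L2 :&: Z) /\ big (U L2 :\: Z).
Proof.
move=> sPZ b1 b2 k2; have kZ : kS Z by case: sPZ => _ [].
have eD X : X :\: ~: Z = X :&: Z by set_decide.
have [s3|b3] := boolP (small (U L2 :&: Z)); last first.
  by split=> //; apply: (stuck_interval_not_inside sPZ).
have [s4|b4] := boolP (small (U L2 :\: Z)).
  by case: (kS_split_big k2 (kS_ksep kZ) s3 s4).
have := stuck_interval_not_inside (stuckC sPZ).
by rewrite -!setDE !eD s3 => /(_ b2 b1 b4).
Qed.

(* What lies between the petal split by [Z] and an interval that belongs to
   [S] meets both sides of [Z] in small sets, and can thus be absorbed. *)
Lemma stuck_same_closures A L1 L2 L3 Z : stuck (A :: L1 ++ L2 ++ L3) Z ->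
  big (A :&: Z) -> big (A :\: Z) -> kS (U L2) ->
  [/\ kS (U (L1 ++ L2 ++ L3)),
      same_closures (U (L1 ++ L2 ++ L3)) (U L2) &
      forall C, C \in L1 ++ L3 -> N \subset C -> N = set0].
Proof.
move=> sPZ b1 b2 k2; have [[[fP _ _] _] [kZ _] rZ _ _] := sPZ.
have eD X : X :\: ~: Z = X :&: Z by set_decide.
have [b3 b4] := stuck_kS_interval sPZ b1 b2 k2.
have [_ _ _ kP] := fP.
have s1 : small (U L1 :&: Z).
  apply/negPn/negP => bL1; apply: (stuck_unsplittable sPZ) => //.
  by apply: bigS b4; rewrite bigcup_cat_seq; set_decide.
have s1C : small (U L1 :\: Z).
  apply/negPn/negP => bL1; have := stuck_unsplittable (stuckC sPZ).
  rewrite -!setDE !eD; apply => //.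
  by apply: bigS b3; rewrite bigcup_cat_seq; set_decide.
have sPZ' := sPZ; rewrite catA in sPZ'.
have s3C : small (U L3 :\: Z).
  apply/negPn/negP => bL1; apply: (stuck_unsplittable sPZ') => //.
  by apply: bigS b3; rewrite bigcup_cat_seq; set_decide.
have s3 : small (U L3 :&: Z).
  apply/negPn/negP => bL1; have := stuck_unsplittable (stuckC sPZ').
  rewrite -!setDE !eD; apply => //.
  by apply: bigS b4; rewrite bigcup_cat_seq; set_decide.
have := list_flower3 (fP : list_flower ([::] ++ [:: A] ++ (L1 ++ L2 ++ L3))).
rewrite bigcup_seq1_set big_nil !bigcup_cat_seq => -[_ _ d _].
have k12 : ksep (U L2 :|: U L1).
  by rewrite setUC -bigcup_cat_seq; apply: (kP [:: A] _ L3); rewrite /= -catA.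
have [||k12S c12] := @kS_absorb (U L2) (U L1) Z (A :\: Z) k2 kZ b3 s1 s1C k12.
- exact: b2.
- set_decide.
have e : (U L2 :|: U L1) :|: U L3 = U L1 :|: (U L2 :|: U L3) by set_decide.
have k123 : ksep ((U L2 :|: U L1) :|: U L3).
  rewrite e -!bigcup_cat_seq; apply: (kP [:: A] _ [::]).
  by rewrite /= cats0.
have [|||kU cU] := @kS_absorb _ (U L3) Z (A :\: Z) k12S kZ _ s3 s3C k123.
- by apply: bigS b3; set_decide.
- exact: b2.
- set_decide.
rewrite e in kU cU; split=> //; first exact: same_closures_trans cU c12.
move=> C; rewrite mem_cat => CL NC; case: N_big => // /negP[].
have : (C \subset U L1) || (C \subset U L3).
  by case/orP: CL => /mem_bigcup_seq ->; rewrite ?orbT.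
case/orP: rZ => NZ /orP[] CL'.
- by apply: smallS s1; set_decide.
- by apply: smallS s3; set_decide.
- by apply: smallS s1C; set_decide.
- by apply: smallS s3C; set_decide.
Qed.

(** An arc through [A] is the complement of the arc formed by the remaining petals. *)
Lemma interval_union_cons A L Y : list_flower (A :: L) ->
  interval_union (A :: L) Y ->
  exists L1 L2 L3, L = L1 ++ L2 ++ L3 /\ (Y = U L2 \/ Y = ~: U L2).
Proof.
move=> fP [[|B M1] [M2 [M3 [/= e eY]]]]; last first.
  by case: e => _ ->; exists M1, M2, M3.
case: M2 e eY => [_|B M2 [eA e]] eY; first by exists [::], [::], L.
rewrite -{}eA e in fP eY *.
exists M2, M3, [::]; rewrite cats0; split=> //.
have [_ _ d c] := list_flower3 (fP : list_flower ([::] ++ (A :: M2) ++ M3)).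
have eC : U (A :: M2) = ~: U M3 by rewrite big_nil in c; set_decide.
by rewrite eC setCK in eY; case: eY; [right|left].
Qed.

(** In this cyclic order, neighbouring quadrants unite to [A], [~: Z], [~: A] and [Z]; the single
    quadrants come from uncrossing. *)
Lemma list_flower_quadrants A Z : ksep A -> ksep Z ->
  big (A :&: Z) -> big (A :\: Z) -> big (Z :\: A) -> big (~: (A :|: Z)) ->
  list_flower [:: A :&: Z; A :\: Z; ~: (A :|: Z); Z :\: A].
Proof.
move=> kA kZ b1 b2 b3 b4.
have k1 : ksep (A :&: Z).
  by apply: ksep_capW; rewrite ?setCU//; [apply: bigS b2|apply: bigS b4]; set_decide.
have k2 : ksep (A :\: Z).
  by apply: ksep_diffW => //; apply: bigS b1; set_decide.
have k3 : ksep (Z :\: A).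
  by apply: ksep_diffW => //; apply: bigS b1; set_decide.
have k4 : ksep (A :|: Z).
  by apply: ksep_cupW => //; apply: bigS b2; set_decide.
split.
- by rewrite /= b1 b2 b3 b4.
- rewrite /=; do !(apply/andP; split) => //; set_decide.
- by rewrite !big_cons big_nil; set_decide.
move=> L1 L2 L3.
have triv : ksep (U [::]) by rewrite big_nil (ksep0 kA).
case: L1 => [|A1 [|A2 [|A3 [|A4 [|A5 L1]]]]] //=.
- case: L2 => [|B1 [|B2 [|B3 [|B4 [|B5 L2]]]]] //= [];
    rewrite ?big_cons ?big_nil ?setU0.
  + by move=> <-.
  + by move=> <- <- _; rewrite (_ : _ :|: _ = A)//; set_decide.
  + move=> <- <- <- _.
    by rewrite (_ : _ :|: _ = ~: (Z :\: A)) ?ksepC//; set_decide.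
  + move=> <- <- <- <- _.
    by rewrite (_ : _ :|: _ = setT) ?(ksepT kA)//; set_decide.
- case: L2 => [|B1 [|B2 [|B3 [|B4 L2]]]] //= [_];
    rewrite ?big_cons ?big_nil ?setU0.
  + by move=> <-.
  + by move=> <- <- _; rewrite (_ : _ :|: _ = ~: Z) ?ksepC//; set_decide.
  + move=> <- <- <- _.
    by rewrite (_ : _ :|: _ = ~: (A :&: Z)) ?ksepC//; set_decide.
- case: L2 => [|B1 [|B2 [|B3 L2]]] //= [_ _];
    rewrite ?big_cons ?big_nil ?setU0.
  + by move=> <-; rewrite ksepC.
  + by move=> <- <- _; rewrite (_ : _ :|: _ = ~: A) ?ksepC//; set_decide.
- case: L2 => [|B1 [|B2 L2]] //= [_ _ _]; rewrite ?big_cons ?big_nil ?setU0.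
  + by move=> <-.
- by case: L2.
Qed.

Lemma stuck_no_split_petal A L Z : stuck (A :: L) Z ->
  big (A :&: Z) -> big (A :\: Z) -> False.
Proof.
move=> sPZ b1 b2; have [b3 b4] := stuck_complement sPZ b1 b2.
have [[[fP hP [X [iX cX pX]]] mP] [kZ uZ] rZ _ nc] := sPZ.
have := list_flower3 (fP : list_flower ([::] ++ [:: A] ++ L)).
rewrite bigcup_seq1_set big_nil => -[_ _ d c].
have eA : A = ~: U L by set_decide.
have kA : ksep A by case: fP => _ _ _ /(_ [::] [:: A] L erefl); rewrite big_seq1.
have fP' : list_flower [:: A :&: Z; A :\: Z; ~: (A :|: Z); Z :\: A].
  apply: list_flower_quadrants => //; first exact: kS_ksep.
    by apply: bigS b3; set_decide.
  by apply: bigS b4; set_decide.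
have pA : interval_union [:: A :&: Z; A :\: Z; ~: (A :|: Z); Z :\: A] A.
  exists [::], [:: A :&: Z; A :\: Z], [:: ~: (A :|: Z); Z :\: A]; split=> //.
  by left; rewrite !big_cons big_nil; set_decide.
(* Besides the common closure, this records why [U L] or [A] is disjoint from [N] when [Y] is: the
   quadrant flower needs an inner separation of maximum closure. *)
have same Y : kS Y -> interval_union (A :: L) Y ->
    kS (U L) /\ (same_closures (U L) Y /\ (forall C, C \in A :: L -> N \subset C -> [disjoint Y & N] -> [disjoint U L & N])
      \/ same_closures A Y /\ A \subset Y).
  move=> kY /(interval_union_cons fP)[L1 [L2 [L3 [eL eY]]]].
  have k2 : kS (U L2) by case: eY kY => ->; rewrite ?kSC.
  have sPZ' := sPZ; rewrite eL in sPZ'.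
  have [kU sc NL] := stuck_same_closures sPZ' b1 b2 k2.
  rewrite -eL in kU sc; split=> //; case: eY => ->; [left|right]; split=> //.
  - move=> C; rewrite eL inE !mem_cat => /predU1P[->|CL] NC dN.
      by rewrite -eL; set_decide.
    suff -> : N = set0 by rewrite -setI_eq0 setI0.
    have [CL2|CL2] := boolP (C \in L2).
      have CU := mem_bigcup_seq CL2; set_decide.
    by apply: (NL C) => //; rewrite mem_cat; move: CL; rewrite (negbTE CL2).
  - by rewrite {1}eA same_closuresC.
  - have U2 : U L2 \subset U L by rewrite eL !bigcup_cat_seq; set_decide.
    set_decide.
have tA Y : kS Y -> interval_union (A :: L) Y -> tequiv Y A.
  move=> kY /(same Y kY)[kU]; have kSA : kS A by rewrite eA kSC.
  case=> -[sc _]; last first.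
    by apply: same_closures_tequiv => //; rewrite same_closures_sym.
  apply: (@tequiv_trans _ (U L)).
    by apply: same_closures_tequiv; rewrite // same_closures_sym.
  by rewrite eA; apply: tequiv_compl.
have [kX uX dX] := iX; have [kU oX] := same X kX pX.
have kSA : kS A by rewrite eA kSC.
have hN := hP.
have [] := mP [:: A :&: Z; A :\: Z; ~: (A :|: Z); Z :\: A].
- split=> //.
    have /hasP[C CP NC] := hP.
    have : (C \subset A) || (C \subset U L).
      by move: CP; rewrite inE => /predU1P[->|/mem_bigcup_seq->]; rewrite ?subxx ?orbT.
    rewrite /= orbF; case/orP: rZ => NZ; case/orP=> CU.
    + by apply/or4P/Or41; set_decide.
    + by apply/or4P/Or44; set_decide.
    + by apply/or4P/Or42; set_decide.
    + by apply/or4P/Or43; set_decide.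
  case: oX => [[sc dU]|[sc AX]].
    exists (U L); split; last by apply: interval_unionC; rewrite -eA.
      split=> //.
        by apply: undisplayed_tequiv uX; apply: same_closures_tequiv; rewrite // same_closures_sym.
      by have /hasP[C CP NC] := hP; apply: dU NC dX.
    by case/andP: sc => /eqP->.
  exists A; split=> //.
    split=> //; last by set_decide.
    by apply: undisplayed_tequiv uX; apply: same_closures_tequiv; rewrite // same_closures_sym.
  by case/andP: sc => /eqP->.
- move=> Y [kY [Y' pY' tY]]; split=> //; exists A => //.
  exact: tequiv_trans tY (tA Y' (tequiv_kS kY tY) pY').
(* The quadrant flower represents [Z] too, whose complement is two consecutive quadrants; by
   maximality the old flower would then represent [Z], against non-conformity. *)
- move=> _ /(_ Z)[].
    split=> //; exists Z; last exact: tequiv_refl.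
    exists [:: A :&: Z], [:: A :\: Z; ~: (A :|: Z)], [:: Z :\: A]; split=> //.
    by right; rewrite !big_cons big_nil; set_decide.
  move=> _ [Y /(interval_union_uncrossed fP) uY tY].
  by apply: nc; left; exists Y.
Qed.

(** * Petals cut into two small parts *)

Definition scattered Z A := small (A :&: Z) && small (A :\: Z).

Lemma scatteredC Z A : scattered (~: Z) A = scattered Z A.
Proof.
rewrite /scattered -setDE (_ : A :\: ~: Z = A :&: Z) 1?andbC//.
by set_decide.
Qed.

Lemma scattered_crossed Z A : big A -> scattered Z A -> crossed Z A.
Proof.
move=> bA /andP[s1 s2]; apply/negP => /orP[AZ|dA].
  by move: bA; rewrite (smallS _ s1)//; set_decide.
by move: bA; rewrite (smallS _ s2)//; set_decide.
Qed.

Lemma stuck_petal P Z A : stuck P Z -> A \in P ->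
  [\/ A \subset Z, [disjoint A & Z] | scattered Z A].
Proof.
move=> sPZ /rot_to[n L eP]; have {eP}sAL : stuck (A :: L) Z.
  by rewrite -eP; apply: stuck_rot.
have inside W : stuck (A :: L) W -> big (A :&: W) -> small (A :\: W) -> A \subset W.
  move=> sW; have := @stuck_interval _ _ [::] [:: A] L sW erefl.
  by rewrite bigcup_seq1_set.
have [s1|b1] := boolP (small (A :&: Z)); have [s2|b2] := boolP (small (A :\: Z)).
- by apply: Or33; rewrite /scattered s1 s2.
- apply: Or32; rewrite disjoints_subset; apply: inside (stuckC sAL) _ _.
    by rewrite -setDE.
  by apply: smallS s1; set_decide.
- by apply: Or31; apply: inside.
- by case: (stuck_no_split_petal sAL b1 b2).
Qed.

(** Where a scattered petal [B] meets a petal [C] on one side of [Z], all but a small part of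
    [B :|: C] is on that side. Then [stuck_interval] puts [B] there entirely, although [B] is
    crossed. *)
Lemma stuck_all_scattered P Z : stuck P Z -> all (scattered Z) P.
Proof.
move=> sPZ; have [[[[/allP bP _ _ _] _ _] _] [kZ _] _ _ nc] := sPZ.
have [cP|nP] := boolP (has (crossed Z) P); last first.
  by case: nc; left; exists Z => //; apply: tequiv_refl.
have [A AP cA] := hasP cP; have [n L eP] := rot_to AP.
have sAL := stuck_rot n sPZ; rewrite eP in sAL.
have bAL : {in A :: L, forall B, big B}.
  by move=> B; rewrite -eP mem_rot; apply: bP.
have AS : scattered Z A.
  by case: (stuck_petal sPZ AP) => // AZ; rewrite /crossed AZ ?orbT in cA.
rewrite -(eq_all_r (mem_rot n P)) eP /= AS /=; apply/negPn/negP; rewrite -has_predC => hL.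
move: sAL bAL; case/split_find: hL => C L1 L2 /= nC hL1.
(* [C] is the first petal that is not scattered; its predecessor [B], the last of [A :: L1], is
   scattered. *)
rewrite -cats1 -catA -cat_cons lastI -cats1 -catA => sML bML.
set B := last A L1 in sML bML; set M := belast A L1 in sML bML.
have BS : scattered Z B.
  have := mem_last A L1; rewrite -/B inE => /predU1P[->//|BL].
  by apply/negPn; apply: (hasPn hL1).
have bB : big B by apply: bML; rewrite !mem_cat mem_head orbT.
have bC : big C by apply: bML; rewrite !mem_cat mem_head !orbT.
have CP : C \in M ++ [:: B] ++ [:: C] ++ L2 by rewrite !mem_cat mem_head !orbT.
have no W : stuck (M ++ [:: B] ++ [:: C] ++ L2) W -> scattered W B ->
    ~ (C \subset W).
  move=> sW /[dup] BW /andP[s1 s2] CW.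
  have := @stuck_interval _ _ M [:: B; C] L2 sW erefl.
  rewrite !big_cons big_nil setU0 subUset => H.
  have /H : big ((B :|: C) :&: W) by apply: bigS bC; set_decide.
  have /[swap]/[apply] : small ((B :|: C) :\: W) by apply: smallS s2; set_decide.
  move=> /andP[BsW _].
  by have := scattered_crossed bB BW; rewrite /crossed BsW.
case: (stuck_petal sML CP) => [CZ|CZ|CS].
- exact: (no _ sML BS CZ).
- apply: (no _ (stuckC sML) _ _); first by rewrite scatteredC.
  by rewrite -disjoints_subset.
- by rewrite CS in nC.
Qed.

Lemma longest_prefix (T : Type) (q : pred (seq T)) a s : q [:: a] ->
  exists s1 s2, [/\ a :: s = (a :: s1) ++ s2, q (a :: s1) &
    forall b s3, s2 = b :: s3 -> ~~ q (a :: s1 ++ [:: b])].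
Proof.
suff H t : q (a :: t) -> exists s1 s2, [/\ a :: t ++ s = (a :: s1) ++ s2,
    q (a :: s1) & forall b s3, s2 = b :: s3 -> ~~ q (a :: s1 ++ [:: b])].
  exact: (H [::]).
elim: s t => [|b s IH] t qt; first by exists t, [::].
have [qb|qb] := boolP (q (a :: t ++ [:: b])).
  have [s1 [s2 [e q1 m1]]] := IH _ qb; exists s1, s2; split=> //.
  by rewrite -e -catA.
by exists t, (b :: s); split=> // c s3 [<- _].
Qed.

Lemma not_stuck P Z : ~ stuck P Z.
Proof.
move=> sPZ; have /allP allS := stuck_all_scattered sPZ.
have [[[fP hP _] _] [kZ _] _ _ _] := sPZ.
have [/allP bP dP cP kP] := fP.
pose q L := scattered Z (U L).
have q1 A : A \in P -> q [:: A] by move=> /allS; rewrite /q bigcup_seq1_set.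
(* If one part were small, [stuck_interval] would put the whole arc on one side of [Z], but its
   first petal is crossed. *)
have nq L1 L2 L3 A : P = L1 ++ (A :: L2) ++ L3 -> ~~ q (A :: L2) ->
    big (U (A :: L2) :&: Z) /\ big (U (A :: L2) :\: Z).
  move=> eP; have AP : A \in P by rewrite eP !mem_cat mem_head orbT.
  have AU : A \subset U (A :: L2) by rewrite mem_bigcup_seq ?mem_head.
  have cA := scattered_crossed (bP _ AP) (allS _ AP).
  rewrite negb_and; have [s1|b1] /= := boolP (small (U (A :: L2) :&: Z)).
    move=> b2; have := stuck_interval (stuckC sPZ) eP.
    rewrite -setDE b2 (_ : _ :\: ~: Z = U (A :: L2) :&: Z); last by set_decide.
    move=> /(_ isT s1) UZ; move: cA; rewrite /crossed.
    by rewrite disjoints_subset (subset_trans AU UZ) orbT.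
  have [s2 _|b2 //] := boolP (small (U (A :: L2) :\: Z)).
  have UZ := stuck_interval sPZ eP b1 s2.
  by move: cA; rewrite /crossed (subset_trans AU UZ).
have E0 : [set: E] != set0 by apply: big_neq0 (bigS (subsetT Z) (kS_big kZ)).
have cover Ls : size Ls <= 4 -> all q Ls -> U (flatten Ls) != setT.
  move=> s4 qLs; rewrite big_flatten; pose h L := [:: U L :&: Z; U L :\: Z].
  have -> : \bigcup_(L <- Ls) U L = U (flatten (map h Ls)).
    elim: Ls {s4 qLs} => [|L Ls IH]; first by rewrite !big_nil.
    by rewrite /= !big_cons IH setUA (_ : U L :&: Z :|: _ = U L)//; set_decide.
  apply: small_cover_neq => //.
    have -> : size (flatten (map h Ls)) = (size Ls).*2; last by lia.
    by elim: Ls {s4 qLs} => //= L Ls ->.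
  by elim: Ls qLs {s4} => //= L Ls IH /andP[/andP[-> ->] /IH].
(* A longest scattered arc, extended by the next petal, is big on both sides of [Z] and can be
   uncrossed with it. *)
have step L1 L2 : P = L1 ++ L2 -> L2 != [::] ->
    exists A M1 M2, [/\ L2 = (A :: M1) ++ M2, q (A :: M1) &
      forall B M3, M2 = B :: M3 ->
        big (U (A :: M1 ++ [:: B]) :&: Z) /\ big (U (A :: M1 ++ [:: B]) :\: Z)].
  case: L2 => // A L2 eP _.
  have [|M1 [M2 [e qM mM]]] := @longest_prefix _ q A L2.
    by apply: q1; rewrite eP mem_cat mem_head orbT.
  exists A, M1, M2; split=> // B M3 eM; apply: (nq L1 _ M3); last exact: mM eM.
  by rewrite eP e eM /= -catA.
have P0 : P != [::].
  by apply: contraNneq E0 => eP; rewrite -cP eP big_nil.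
have [A1 [M1 [L1 [e1 qM1 b1]]]] := step [::] P erefl P0.
have L10 : L1 != [::].
  apply: contraNneq (cover [:: A1 :: M1] isT _); last by rewrite /= qM1.
  by rewrite -cP e1 => ->.
have [A2 [M2 [L2 [e2 qM2 b2]]]] := step _ _ e1 L10.
rewrite {}e2 in e1 b1 L10.
have L20 : L2 != [::].
  apply: contraNneq (cover [:: A1 :: M1; A2 :: M2] isT _); last by rewrite /= qM1 qM2.
  by rewrite -cP e1 => ->.
have e1' : P = ((A1 :: M1) ++ (A2 :: M2)) ++ L2 by rewrite e1 -catA.
have [A3 [M3 [L3 [e3 qM3 b3]]]] := step _ _ e1' L20.
rewrite {}e3 in e1 e1' b2 L20.
have L30 : L3 != [::].
  apply: contraNneq (cover [:: A1 :: M1; A2 :: M2; A3 :: M3] isT _);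
    last by rewrite /= qM1 qM2 qM3.
  by rewrite -cP e1 => ->.
have e1'' : P = ((A1 :: M1) ++ (A2 :: M2) ++ (A3 :: M3)) ++ L3 by rewrite e1 -!catA.
have [A4 [M4 [L4 [e4 qM4 b4]]]] := step _ _ e1'' L30.
rewrite {}e4 in e1 e1' e1'' b3 L30.
have : L4 != [::].
  apply: contraNneq (cover [:: A1 :: M1; A2 :: M2; A3 :: M3; A4 :: M4] isT _);
    last by rewrite /= qM1 qM2 qM3 qM4.
  by rewrite -cP e1 => ->.
case: L4 e1 e1' e1'' b3 b4 {L30} => // A5 L4 e1 e1' e1'' b3 b4 _.
(* The first arc extended by [A2] and the second extended by [A3] meet exactly in [A2]. The fourth
   extended by [A5] avoids both and supplies the big set outside their union with [Z]. Hence
   [Z :|: A2] is k-separating, and [A2] need not be crossed. *)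
have [c1 _] := b1 _ _ erefl; have [c2 _] := b2 _ _ erefl.
have [_ c4] := b4 _ _ erefl.
have A2P : A2 \in P by rewrite e1 !mem_cat mem_head !orbT.
have := scattered_crossed (bP _ A2P) (allS _ A2P); apply/negP.
have kI L R R' : P = L ++ R ++ R' -> big (U R :&: Z) -> ksep (Z :|: U R).
  move=> eP bR; apply: ksep_cupW; rewrite ?(kS_ksep kZ) ?(kP L R R')//.
    by rewrite setIC.
  by apply: bigS (kS_big_compl kZ); set_decide.
have k1 := kI [::] (A1 :: M1 ++ [:: A2]) (M2 ++ (A3 :: M3) ++ (A4 :: M4) ++ A5 :: L4).
have k2 := kI (A1 :: M1) (A2 :: M2 ++ [:: A3]) (M3 ++ (A4 :: M4) ++ A5 :: L4).
have {}k1 : ksep (Z :|: U (A1 :: M1 ++ [:: A2])).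
  by apply: k1 => //; rewrite e1 /= -!catA.
have {}k2 : ksep (Z :|: U (A2 :: M2 ++ [:: A3])).
  by apply: k2 => //; rewrite e1 /= -!catA.
apply: (@stuck_absorb _ _ [:: A2] _ sPZ); rewrite ?mem_head//.
- by move=> B; rewrite inE => /eqP->.
- by rewrite bigcup_seq1_set; have /andP[] := allS _ A2P.
have [d1 d2 d3 _] : [/\ [disjoint U (A1 :: M1) & U (A2 :: M2 ++ [:: A3])],
    [disjoint U (A1 :: M1) & U (M3 ++ (A4 :: M4) ++ A5 :: L4)],
    [disjoint U (A2 :: M2 ++ [:: A3]) & U (M3 ++ (A4 :: M4) ++ A5 :: L4)] & True].
  have [] := @list_flower3 (A1 :: M1) (A2 :: M2 ++ [:: A3]) (M3 ++ (A4 :: M4) ++ A5 :: L4).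
    by move: fP; rewrite e1 /= -!catA.
  by split.
have s45 : U (A4 :: M4 ++ [:: A5]) \subset U (M3 ++ (A4 :: M4) ++ A5 :: L4).
  rewrite bigcup_seq_sub; apply/allP => B BL; apply: mem_bigcup_seq.
  by move: BL; rewrite !(inE, mem_cat) => /or3P[]->; rewrite ?orbT.
rewrite bigcup_seq1_set.
have eA2 : U (A1 :: M1 ++ [:: A2]) = U (A1 :: M1) :|: A2.
  by rewrite -cat_cons bigcup_cat_seq bigcup_seq1_set.
have sA2 : A2 \subset U (A2 :: M2 ++ [:: A3]) by rewrite mem_bigcup_seq ?mem_head.
rewrite eA2 in k1.
rewrite (_ : Z :|: A2 = (Z :|: (U (A1 :: M1) :|: A2)) :&: (Z :|: U (A2 :: M2 ++ [:: A3])));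
  last by set_decide.
apply: ksep_capW => //; first by apply: bigS (kS_big kZ); set_decide.
by apply: bigS c4; set_decide.
Qed.

Lemma maximal_conforming P Z : admissible P -> maximal P -> inner_kS Z ->
  conforming P Z.
Proof.
move=> aP mP [kZ uZ dZ]; have [//|nc] := pselect (conforming P Z).
have Q0 : tequiv Z Z && respects Z.
  by rewrite tequiv_refl// /respects (disjoint_sym N) dZ orbT.
case: (@arg_minnP _ Z (fun W => tequiv Z W && respects W)
  (fun W => count (crossed W) P) Q0) => W /andP[tW rW] minW.
case: (@not_stuck P W); split=> //.
- by split; [apply: tequiv_kS tW|apply: undisplayed_tequiv uZ].
- move=> W' tW' rW'; apply: minW; rewrite rW' andbT.
  exact: tequiv_trans tW'.
- case=> [[Y uY tY]|[Y [A [AP YA tY]]]]; apply: nc.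
    by left; exists Y => //; apply: tequiv_trans tY.
  by right; exists Y, A; split=> //; apply: tequiv_trans tY.
Qed.

(** * Existence of a maximal flower *)

Lemma size_le_card_bigcup L : all (fun A : {set E} => A != set0) L ->
  disjoint_petals L -> size L <= #|U L|.
Proof.
elim: L => //= A L IH /andP[A0 L0] /andP[AL dL].
rewrite big_cons cardsU (_ : A :&: U L = set0) ?cards0 ?subn0.
  by rewrite -addn1 addnC leq_add ?card_gt0 ?IH.
by apply/eqP; rewrite setI_eq0 disjoint_sym bigcup_seq_disjoint;
  apply: sub_all AL => B /=; rewrite disjoint_sym.
Qed.

Lemma size_list_flower P : list_flower P -> size P <= #|E|.
Proof.
move=> [bP dP _ _]; apply: leq_trans (max_card (mem (U P))).
by apply: size_le_card_bigcup dP; apply: sub_all bP => A; apply: big_neq0.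
Qed.

Lemma exists_maximal P : admissible P -> exists2 Q, admissible Q & maximal Q.
Proof.
move=> aP; pose r Q := [set Y | `[< represents Q Y >]].
(* A lexicographic order in one number: a flower has at most [#|E|] petals, so one more represented
   set outweighs any loss of petals. *)
pose mu Q := #|r Q| * #|E|.+1 + size Q.
pose a n := `[< exists2 Q, admissible Q & mu Q = n >].
have a0 : exists n, a n by exists (mu P); apply/asboolP; exists P.
have bound n : a n -> n <= #|{set E}| * #|E|.+1 + #|E|.
  move=> /asboolP[Q [fQ _ _] <-].
  by rewrite leq_add ?size_list_flower// leq_mul2r max_card orbT.
have [n /asboolP[Q aQ <-] nmax] := ex_maxnP a0 bound.
exists Q => // Q' aQ' QQ'.
have fQ : list_flower Q by case: aQ.
have [fQ' _ _] := aQ'.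
have rS : r Q \subset r Q'.
  by apply/subsetP => Y; rewrite !inE => /asboolP/QQ'/asboolP.
have : mu Q' <= mu Q by apply: nmax; apply/asboolP; exists Q'.
rewrite /mu => muQ; have sQ := size_list_flower fQ.
have rE : r Q = r Q'.
  apply/eqP; rewrite eqEcard rS /= leqNgt; apply/negP => lt.
  move: muQ; rewrite leqNgt => /negP[].
  apply: leq_trans (leq_addr _ _); apply: leq_trans (_ : #|r Q|.+1 * #|E|.+1 <= _).
    by rewrite mulSn addnC ltn_add2r ltnS.
  by rewrite leq_mul2r lt orbT.
split; first by rewrite rE leq_add2l in muQ.
move=> Y /asboolP RY; have : Y \in r Q by rewrite rE inE.
by rewrite inE => /asboolP.
Qed.

(** Largest closure and maximality have served to prove conformity; they are dropped here so that
    petals can be merged. *)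
Definition candidate P : Prop :=
  [/\ list_flower P, has (fun A => N \subset A) P,
      exists X, [/\ kS X, undisplayed X & uncrossed P X] &
      forall Z, inner_kS Z -> conforming P Z].

Lemma uncrossed_sub P A X : uncrossed P X -> A \in P ->
  (A \subset X) || (A \subset ~: X).
Proof. by move=> uX AP; rewrite -disjoints_subset (uncrossedP uX AP). Qed.

Lemma list_flower_pair X : kS X -> list_flower [:: X; ~: X].
Proof.
move=> kX; have ksX := kS_ksep kX; split.
- by rewrite /= kS_big ?kS_big_compl.
- by rewrite /= !andbT; set_decide.
- by rewrite !big_cons big_nil; set_decide.
move=> [|A1 [|A2 [|A3 L1]]] L2 L3 //=.
- case: L2 => [|B1 [|B2 [|B3 L2]]] //= []; rewrite ?big_cons ?big_nil ?setU0.
  + by move=> _; apply: ksep0 ksX.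
  + by move=> <-.
  + by move=> <- <- _; rewrite setUCr (ksepT ksX).
- case: L2 => [|B1 [|B2 L2]] //= [_]; rewrite ?big_cons ?big_nil ?setU0.
  + by move=> _; apply: ksep0 ksX.
  + by move=> <-; rewrite ksepC.
- by case: L2 => // _; rewrite big_nil; apply: ksep0 ksX.
Qed.

(** When all displayed separations form one class, [X] stands for each of them, and every petal lies
    in one of its sides. *)
Lemma candidate_pair P X : candidate P -> kS X -> undisplayed X ->
  uncrossed P X ->
  (forall Y, kS Y -> uncrossed P Y -> tequiv Y X) -> candidate [:: X; ~: X].
Proof.
move=> cP kX uX ucX sameX; have [fP hP _ confP] := cP.
have uX' : uncrossed [:: X; ~: X] X.
  have d : [disjoint ~: X & X] by set_decide.
  by rewrite /uncrossed /= /crossed subxx d !orbT.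
split=> //.
- exact: list_flower_pair.
- have /hasP[A AP NA] := hP; have := uncrossed_sub ucX AP.
  by rewrite /= orbF => /orP[] AX; apply/orP; [left|right]; apply: subset_trans AX.
- by exists X.
move=> Z iZ; have [kZ _ _] := iZ.
case: (confP Z iZ) => [[Y uY tY]|[Y [A [AP YA tY]]]].
  by left; exists X => //; apply: tequiv_trans tY (sameX Y (tequiv_kS kZ tY) uY).
right; case/orP: (uncrossed_sub ucX AP) => AX.
  by exists Y, X; split; rewrite ?mem_head// (subset_trans YA)// setSD.
exists Y, (~: X); split; rewrite ?inE ?eqxx ?orbT//.
by rewrite (subset_trans YA)// setSD.
Qed.

Lemma list_flower_merge A B L : list_flower [:: A, B & L] ->
  list_flower ((A :|: B) :: L).
Proof.
case=> bP dP cP kP; split.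
- by move: bP => /= /and3P[bA _ ->]; rewrite andbT; apply: bigS bA; apply: subsetUl.
- move: dP => /= /andP[/andP[dAB /allP dA] /andP[/allP dB ->]]; rewrite andbT.
  apply/allP => C CL; have dAC := dA C CL; have dBC := dB C CL.
  by clear -dAC dBC; set_decide.
- by rewrite -cP !bigcup_cons_seq setUA.
move=> [|C L1] L2 L3 /=.
  case: L2 => [_|C L2 [<- e]].
    by rewrite big_nil; apply: (ksep0 (kP [::] [:: A] (B :: L) erefl)).
  rewrite bigcup_cons_seq -setUA -!bigcup_cons_seq.
  by apply: (kP [::] [:: A, B & L2] L3); rewrite e.
by move=> [_ e]; apply: (kP [:: A, B & L1] L2 L3); rewrite e.
Qed.

(** Adding the loose petal [A] to the side that contains [B] stays inside the closure of that side,
    so every displayed class survives. *)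
Lemma candidate_merge P A B L : candidate P -> perm_eq P [:: A, B & L] ->
  list_flower ((A :|: B) :: L) -> ksep (A :|: B) -> A \subset fcl B ->
  candidate ((A :|: B) :: L).
Proof.
move=> [fP hP [X [kX uX ucX]] confP] pP fP' kAB AB.
have AP : A \in P by rewrite (perm_mem pP) mem_head.
have BP : B \in P by rewrite (perm_mem pP) !inE eqxx orbT.
have bB : big B by case: fP => /allP bP _ _ _; apply: bP.
have shift Y : kS Y -> uncrossed P Y ->
    exists Y', [/\ kS Y', tequiv Y Y' & uncrossed ((A :|: B) :: L) Y'].
  wlog BY : Y / B \subset Y => [H|] kY uY.
    have [BY|nBY] := boolP (B \subset Y); first exact: H.
    have dBY : B \subset ~: Y.
      by rewrite -disjoints_subset; case/orP: (uncrossedP uY BP) nBY => // ->.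
    have [||Y' [kY' tY' uY']] := H (~: Y) dBY; rewrite ?kSC ?uncrossedC//.
    exists Y'; split=> //; apply: tequiv_trans tY'; exact: tequiv_compl.
  have [kY' sc] : kS (Y :|: A) /\ same_closures (Y :|: A) Y.
    apply: kS_between => //; last 2 first.
    - exact: subsetUl.
    - by rewrite subUset fcl_sub (subset_trans AB) ?fcl_mono ?(subset_trans BY) ?fcl_sub.
    rewrite (_ : Y :|: A = Y :|: (A :|: B)); last by clear -BY; set_decide.
    apply: ksep_cupW => //; first exact: kS_ksep.
      by apply: bigS bB; clear -BY; set_decide.
    by apply: bigS (kS_big_compl kY); set_decide.
  exists (Y :|: A); split=> //.
    by apply: same_closures_tequiv; rewrite // same_closures_sym.
  apply/hasPn => C; rewrite negbK inE => /predU1P[->|CL]; apply/orP.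
    by left; clear -BY; set_decide.
  have CP : C \in P by rewrite (perm_mem pP) !inE CL !orbT.
  have dC : [disjoint A :|: B & C].
    by case: fP' => _ /= /andP[/allP/(_ C CL)].
  by case/orP: (uncrossedP uY CP) => CY; [left|right]; clear -CY dC; set_decide.
split=> //.
- move: hP; rewrite (eq_has_r (perm_mem pP)) /= => /or3P[NA|NB|->]; rewrite ?orbT//.
    by rewrite (subset_trans NA) ?subsetUl.
  by rewrite (subset_trans NB) ?subsetUr.
- have [Y [kY tY uY]] := shift X kX ucX; exists Y; split=> //.
  exact: undisplayed_tequiv uX.
move=> Z iZ; have [kZ _ _] := iZ.
case: (confP Z iZ) => [[Y uY tY]|[Y [C [CP YC tY]]]].
  have [Y' [_ tY' uY']] := shift Y (tequiv_kS kZ tY) uY.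
  by left; exists Y' => //; apply: tequiv_trans tY tY'.
right; move: CP; rewrite (perm_mem pP) !inE => /or3P[/eqP eC|/eqP eC|CL].
- exists Y, (A :|: B); split; rewrite ?mem_head// (subset_trans YC)// eC setSD//.
  exact: subsetUl.
- exists Y, (A :|: B); split; rewrite ?mem_head// (subset_trans YC)// eC setSD//.
  exact: subsetUr.
- by exists Y, C; split; rewrite ?inE ?CL ?orbT.
Qed.

Lemma exists_candidate P : admissible P -> exists Q, candidate Q.
Proof.
move=> /exists_maximal[Q aQ mQ]; exists Q; have [fQ hQ [X [[kX uX _] _ iX]]] := aQ.
split=> //; first by exists X; split=> //; apply: interval_union_uncrossed.
by move=> Z; apply: maximal_conforming.
Qed.

Definition minimal_candidate P : Prop :=
  candidate P /\ forall Q, candidate Q -> size P <= size Q.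

Lemma exists_minimal_candidate P : admissible P -> exists Q, minimal_candidate Q.
Proof.
move=> /exists_candidate[Q cQ].
pose a n := `[< exists2 Q, candidate Q & size Q = n >].
have a0 : exists n, a n by exists (size Q); apply/asboolP; exists Q.
have [n /asboolP[R cR <-] nmin] := ex_minnP a0; exists R; split=> // R' cR'.
by apply: nmin; apply/asboolP; exists R'.
Qed.

Lemma minimal_candidate_rot n P : minimal_candidate P -> minimal_candidate (rot n P).
Proof.
move=> [[fP hP [X [kX uX ucX]] confP] mP].
have pP : perm_eq P (rot n P) by rewrite perm_sym perm_rot.
split; last by move=> Q /mP; rewrite size_rot.
split; first exact: list_flower_rot.
- by rewrite (eq_has_r (mem_rot n P)).
- by exists X; rewrite -(uncrossed_perm _ pP).
move=> Z /confP[[Y uY tY]|[Y [A [AP YA tY]]]]; [left|right].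
  by exists Y; rewrite -?(uncrossed_perm _ pP).
by exists Y, A; rewrite mem_rot.
Qed.

Lemma minimal_candidate_tight P A B L : minimal_candidate P ->
  perm_eq P [:: A, B & L] -> list_flower [:: A, B & L] ->
  ~~ (A \subset fcl B) && ~~ (B \subset fcl A).
Proof.
move=> [cP mP] pP fP; have fM := list_flower_merge fP.
have kAB : ksep (A :|: B).
  by have [_ _ _ /(_ [::] [:: A; B] L erefl)] := fP; rewrite !big_cons big_nil setU0.
apply/andP; split; apply/negP => AB.
  by have := mP _ (candidate_merge cP pP fM kAB AB); rewrite (perm_size pP) /= ltnn.
have pP' : perm_eq P [:: B, A & L].
  by apply: (perm_trans pP); rewrite -!(cat1s _ (_ :: L)) -!(cat1s _ L) perm_catCA.
rewrite setUC in fM kAB.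
by have := mP _ (candidate_merge cP pP' fM kAB AB); rewrite (perm_size pP) /= ltnn.
Qed.

Lemma candidate_size P : candidate P -> 1 < size P.
Proof.
case=> [[_ _ cP _] _ [X [kX _ ucX]] _]; rewrite ltnNge; apply/negP.
have nX : (X != set0) && (X != setT).
  rewrite big_neq0 ?kS_big//=; apply: contraTneq (kS_big_compl kX) => ->.
  by rewrite setCT negbK small0.
case: P cP ucX => [|A [|//]] cP ucX _.
  by move: nX; rewrite -cP big_nil; have := subsetT X; rewrite -cP big_nil subset0 => ->.
rewrite bigcup_seq1_set in cP; have := uncrossedP ucX (mem_head _ _).
rewrite cP subTset disjoint_sym disjoints_subset setCT subset0.
by case/andP: nX => /negbTE-> /negbTE->.
Qed.

(** With a single class, [candidate_pair] would give a candidate with two petals. *)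
Lemma minimal_candidate_two_classes P : minimal_candidate P -> 2 < size P ->
  exists X Y, [/\ kS X /\ uncrossed P X, kS Y /\ uncrossed P Y & ~~ tequiv X Y].
Proof.
move=> [cP mP] P3; have [_ _ [X [kX uX ucX]] _] := cP.
have [[Y [kY uY nt]]|same] := pselect (exists Y, [/\ kS Y, uncrossed P Y & ~~ tequiv Y X]).
  by exists Y, X.
have /mP : candidate [:: X; ~: X].
  apply: (candidate_pair cP) => // Y kY uY; apply/negPn/negP => nt.
  by case: same; exists Y.
by rewrite leqNgt P3.
Qed.

End Conformity.

End Separations.

(** * Refining a tree at a bag *)

Section Refinement.
Variables (E : finType) (lam : {set E} -> int) (k : nat).
Variables (Tg S : {set {set E}}) (T : ptree E) (b : pt_V T).
Hypothesis lamP : connectivity_system lam.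
Hypothesis TgP : robust_tangle lam k Tg.
Hypothesis SP : tree_compatible lam k Tg S.
Hypothesis TP : partial_tree lam k Tg S T.
Hypothesis bP : pt_isbag T b.

Local Notation ksep := (ksep lam k).
Local Notation kS := (kS_sep lam k S).
Local Notation tequiv := (tequiv lam k Tg).
Local Notation strong_ksep := (strong_ksep lam k Tg).
Local Notation uncrossed := (@uncrossed E).

Definition undisplayed Z : Prop :=
  ~ exists2 Y, tree_displays lam k T Y & tequiv Z Y.

Local Notation outside := (~: pt_bag T b).

Lemma undisplayed_tequiv X Y : tequiv X Y -> undisplayed X -> undisplayed Y.
Proof.
move=> XY uX [Z dZ YZ]; apply: uX; exists Z => //.
exact: tequiv_trans XY YZ.
Qed.

Lemma strong_ksepC (X : {set E}) : strong_ksep (~: X) = strong_ksep X.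
Proof. by rewrite /Defs.strong_ksep setCK (ksepC k lamP) andbCA. Qed.

Lemma bag_sub_eside u : pt_adj T b u -> pt_bag T b \subset eside b u.
Proof.
move=> bu; apply/subsetP => x xb; apply/mem_eside; exists b; rewrite ?connect0//.
by rewrite /bagset bP.
Qed.

(** An element outside the bag sits at another vertex, so [b] has an incident edge, and by (P1) its
    far side is a strong set inside [outside]. *)
Lemma outside_big : outside = set0 \/ ~~ small Tg outside.
Proof.
have [piT [P1 _]] := TP.
have [->|N0] := eqVneq outside set0; [by left|right].
rewrite /small (negbTE N0) /=; apply/negP => wN.
have [x xN] := set0Pn _ N0; have [w xw] := bagset_cover piT x.
have wb : b != w.
  by apply: contraTneq xN => ->; move: xw; rewrite /bagset inE negbK; case: ifP; rewrite ?inE.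
have [[_ [_ [_ [conn _]]]] _] := piT.
have /connectP[[|u p] /=] := conn b w; first by move=> _ e; rewrite e eqxx in wb.
move=> /andP[bu _] _; have bub := bag_sub_eside bu.
have /andP[/and3P[_ sC _] _] := P1 b u bu.
case/negP: sC; case/existsP: wN => A /andP[AT NA]; apply/existsP; exists A.
by rewrite AT (subset_trans _ NA)// setCS.
Qed.

(** * The tree grafted along a minimal flower *)

Section Flower.
Variables (P0 : {set E}) (Ps : seq {set E}).
Hypothesis minP : minimal_candidate lam k Tg S outside undisplayed (P0 :: Ps).
Hypothesis NP0 : outside \subset P0.

Let center_bag := size (P0 :: Ps) == 2.
Let center_D := ~~ `[< forall W, uncrossed (P0 :: Ps) W -> ksep W >].
Local Notation T' := (graft b P0 Ps center_bag center_D).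

Let flowerP : list_flower lam k Tg (P0 :: Ps).
Proof. by have [[]] := minP. Qed.

Let size_gt1 : 1 < size (P0 :: Ps).
Proof. by have [cP _] := minP; apply: candidate_size cP. Qed.

Let disjP : pairwise (fun A B : {set E} => [disjoint A & B]) (P0 :: Ps).
Proof. by case: flowerP. Qed.

Let coverP : P0 :|: \bigcup_(A <- Ps) A = setT.
Proof. by case: flowerP => _ _; rewrite big_cons. Qed.

Let Ps_sub : all (fun A : {set E} => A \subset pt_bag T b) Ps.
Proof.
move: disjP => /= /andP[/allP d _]; apply/allP => A /d dA.
have N0 := NP0; clear -dA N0; by set_decide.
Qed.

Let piT : pi_labelled T. Proof. by case: TP. Qed.

Let piT' : pi_labelled T'.
Proof. exact: graft_pi_labelled. Qed.

Let nonbag_neq v : ~~ pt_isbag T v -> v != b.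
Proof. by apply: contraNneq => ->. Qed.

Let vflower_old v : ~~ pt_isbag T v -> @vflower E T' (inl v) = vflower v.
Proof.
move=> nv; apply: graft_vflower_old => //; first exact: nonbag_neq.
  by have [[_ [_ []]]] := piT.
by move=> Dv; have [_ [_ [_ [PD _]]]] := TP; case: (PD v nv Dv).
Qed.

Lemma graft_displays Y : tree_displays lam k T Y -> tree_displays lam k T' Y.
Proof.
move=> [[u [w [uw [eY kY]]]]|[v [nv fv]]]; [left|right].
  by exists (inl u), (inl w); rewrite graft_eside_old.
by exists (inl v); split=> //; rewrite vflower_old.
Qed.

Let two_petals X : size (P0 :: Ps) = 2 -> kS X -> uncrossed (P0 :: Ps) X ->
  X = P0 \/ X = ~: P0.
Proof.
move=> P2 kX uX; have dP := disjP; have cP := coverP.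
case: (Ps) P2 uX dP cP => [|P1 [|//]] //= _ uX; rewrite big_seq1 !andbT => d c.
have u0 := uncrossedP uX (mem_head _ _).
have u1 : (P1 \subset X) || [disjoint P1 & X].
  by apply: uncrossedP uX _; rewrite !inE eqxx orbT.
have X0 := big_neq0 (kS_big lamP SP kX).
have XC0 := big_neq0 (kS_big_compl lamP SP kX).
case/orP: u0 => s0; case/orP: u1 => s1.
- case/eqP: XC0; clear -s0 s1 c; by set_decide.
- left; clear -s0 s1 c; by set_decide.
- right; clear -s0 s1 c d; by set_decide.
- case/eqP: X0; clear -s0 s1 c; by set_decide.
Qed.

Let two_petals_kS : size (P0 :: Ps) = 2 -> kS P0.
Proof.
move=> P2; have [[_ _ [X [kX _ uX]] _] _] := minP.
by case: (two_petals P2 kX uX) => eX; [|rewrite -(kSC k S lamP)]; rewrite -eX.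
Qed.

Let petal_strong_ksep A : A \in P0 :: Ps -> strong_ksep A.
Proof.
move=> AP; have [n L eP] := rot_to AP.
have fR := list_flower_rot lamP n flowerP; rewrite eP in fR.
have [bR _ _ kR] := fR.
have kA : ksep A by have := kR [::] [:: A] L erefl; rewrite big_seq1.
have L0 : L != [::].
  apply: contraTneq size_gt1 => L0; rewrite -(size_rot n) eP L0.
  by [].
have LS : {subset L <= A :: L} by move=> B BL; rewrite inE BL orbT.
have bL := list_flower_big fR LS L0.
have [_ _ d c] := list_flower3 (fR : list_flower lam k Tg ([::] ++ [:: A] ++ L)).
rewrite bigcup_seq1_set in d.
rewrite /Defs.strong_ksep kA andbT !big_strong//; last by case/andP: bR.
by apply: bigS bL; clear -d; set_decide.
Qed.

Let graft_displays_uncrossed X : kS X -> uncrossed (P0 :: Ps) X ->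
  tree_displays lam k T' X.
Proof.
move=> kX uX; have [P2|P2] := eqVneq (size (P0 :: Ps)) 2.
  left; have e0 := graft_eside_old_center center_bag center_D piT bP disjP coverP Ps_sub.
  case: (two_petals P2 kX uX) => eX.
    by exists (inl b), (inr None); rewrite e0 /= eqxx (kS_ksep kX).
  exists (inr None), (inl b); rewrite (esideC piT' (_ : pt_adj T' (inl b) (inr None))) /= ?eqxx//.
  by rewrite e0 (kS_ksep kX).
right; exists (inr None); split; first by rewrite /= /center_bag.
rewrite graft_vflower_center//; apply/(flower_displaysE _ flowerP).
by split=> //; apply: kS_ksep kX.
Qed.

Let graft_conforms Z : kS Z -> conforms lam k Tg T' Z.
Proof.
move=> kZ; have [_ [_ [_ [_ P5]]]] := TP.
have [sZ cZ] := P5 Z kZ; split=> //.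
case: cZ => [[Y [dY tY]]|[Y [w [bw [Yw tY]]]]].
  by left; exists Y; split=> //; apply: graft_displays.
have [eb|wb] := eqVneq w b; last first.
  by right; exists Y, (inl w); rewrite /= (negbTE wb).
rewrite {}eb in Yw bw; have kY := tequiv_kS SP kZ tY.
have [Y0 [kY0 Y0b tY0]] : exists Y0, [/\ kS Y0, Y0 \subset pt_bag T b & tequiv Z Y0].
  case: Yw => Yb; first by exists Y.
  exists (~: Y); rewrite (kSC k S lamP); split=> //.
  exact: tequiv_trans tY (tequiv_compl lamP SP kY).
have [[Y1 dY1 tY1]|uY0] := pselect (exists2 Y', tree_displays lam k T Y' & tequiv Y0 Y').
  left; exists Y1; split; first exact: graft_displays.
  exact: tequiv_trans tY0 tY1.
have iY0 : inner_kS lam k S outside undisplayed Y0.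
  by split=> //; rewrite disjoints_subset setCK.
have [[_ _ _ conf] _] := minP.
(* An uncrossed set is displayed at the centre; a set inside a petal without [N] lies in the reduced
   bag of [b] or in the bag of a leaf. *)
case: (conf Y0 iY0) => [[Y1 uY1 tY1]|[Y1 [A [AP Y1A tY1]]]].
  left; exists Y1; split; last exact: tequiv_trans tY0 tY1.
  by apply: graft_displays_uncrossed => //; apply: tequiv_kS tY1.
have tZ := tequiv_trans tY0 tY1; right.
move: AP; rewrite inE => /predU1P[eA|/(nthP set0)[i iP eA]].
  exists Y1, (inl b); split=> //; split=> //; left.
  by rewrite /= eqxx; rewrite eA in Y1A; clear -Y1A; set_decide.
exists Y1, (inr (Some (Ordinal iP))); split=> //; split=> //; left.
by rewrite /= eA (subset_trans Y1A) ?subsetDl.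
Qed.

Let graft_edges u w : pt_adj T' u w ->
  strong_ksep (@eside E T' u w) &&
  (pt_isbag T' u && pt_isbag T' w ==> kS (@eside E T' u w)).
Proof.
have e0 := graft_eside_old_center center_bag center_D piT bP disjP coverP Ps_sub.
have ei i : @eside E T' (inr (Some i)) (inr None) = nth set0 Ps i.
  exact: graft_eside_leaf.
have sym u' w' : pt_adj T' u' w' ->
    strong_ksep (@eside E T' u' w') &&
      (pt_isbag T' u' && pt_isbag T' w' ==> kS (@eside E T' u' w')) ->
    strong_ksep (@eside E T' w' u') &&
      (pt_isbag T' w' && pt_isbag T' u' ==> kS (@eside E T' w' u')).
  by move=> a; rewrite (esideC piT' a) strong_ksepC (kSC k S lamP) [pt_isbag _ w' && _]andbC.
have center : strong_ksep (@eside E T' (inl b) (inr None)) &&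
    (pt_isbag T' (inl b) && pt_isbag T' (inr None) ==> kS (@eside E T' (inl b) (inr None))).
  rewrite e0 petal_strong_ksep ?mem_head//=; apply/implyP => /andP[_ /eqP].
  exact: two_petals_kS.
have leaf i : strong_ksep (@eside E T' (inr (Some i)) (inr None)) &&
    (pt_isbag T' (inr (Some i)) && pt_isbag T' (inr None) ==>
      kS (@eside E T' (inr (Some i)) (inr None))).
  rewrite ei petal_strong_ksep ?inE ?mem_nth ?orbT//=; apply/implyP => /eqP P2.
  have [P1 eP] : exists P1, Ps = [:: P1].
    by move: P2; case: (Ps) => [|P1 [|]] // _; exists P1.
  have -> : nth set0 Ps i = ~: P0.
    have : nth set0 Ps i \in [:: P1] by rewrite -eP mem_nth.
    rewrite inE => /eqP->; have dP := disjP; have cP := coverP.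
    rewrite eP /= big_seq1 !andbT in dP cP; clear -dP cP.
    by set_decide.
  by rewrite (kSC k S lamP) two_petals_kS.
move: u w => [u|[i|]] [w|[j|]] // uw.
- by rewrite graft_eside_old//; have [_ [P1 _]] := TP; apply: P1.
- by move: uw => /= /eqP->.
- move: uw => /= /eqP->.
  exact (sym (inl b) (inr None) (eqxx b) center).
- exact (sym (inr (Some j)) (inr None) isT (leaf j)).
Qed.

Let tight A B L : perm_eq (P0 :: Ps) [:: A, B & L] ->
  list_flower lam k Tg [:: A, B & L] ->
  ~~ (A \subset fcl lam k Tg B) && ~~ (B \subset fcl lam k Tg A).
Proof. exact: (minimal_candidate_tight lamP TgP SP undisplayed_tequiv minP). Qed.

Let center_anemone : ~~ center_bag -> ~~ center_D ->
  anemone lam k Tg (P0 :: Ps) /\ no_loose_anemone lam k Tg (P0 :: Ps).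
Proof.
rewrite negbK => _ /asboolP allk; split; first exact: list_flower_anemone.
exact: (no_loose_anemoneP flowerP allk tight).
Qed.

Let center_daisy : ~~ center_bag -> center_D ->
  daisy lam k Tg (P0 :: Ps) /\ no_loose_daisy lam k Tg (P0 :: Ps).
Proof.
move=> _ /asboolPn/existsNP[W /not_implyP[uW nW]]; split.
  by apply: (list_flower_daisy lamP TgP flowerP _ uW) => //; apply/negP.
exact: (no_loose_daisyP lamP flowerP tight).
Qed.

Let center_order : ~~ center_bag -> Sorder_ge3 lam k Tg S (P0 :: Ps).
Proof.
move=> P2; have P3 : 2 < size (P0 :: Ps) by rewrite ltn_neqAle eq_sym P2.
have [X [Y [[kX uX] [kY uY] nt]]] := minimal_candidate_two_classes lamP SP minP P3.
exact: (list_flower_Sorder lamP SP flowerP kX uX kY uY nt).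
Qed.

Lemma graft_partial_tree : partial_tree lam k Tg S T'.
Proof.
have [_ [P1 [P3 [P4 P5]]]] := TP.
have vc := graft_vflower_center center_bag center_D piT bP disjP coverP Ps_sub.
split; first exact: piT'.
split; first exact: graft_edges.
split.
  move=> [v|[i|]] // nv nD; first by rewrite vflower_old//; apply: P3.
  by rewrite vc; have [] := center_anemone nv nD; have := center_order nv.
split; last exact: graft_conforms.
move=> [v|[i|]] // nv Dv.
  rewrite vflower_old//; have [pv rest] := P4 v nv Dv; split=> //.
  by rewrite graft_nbrs_old ?nonbag_neq//; apply: perm_map.
rewrite vc graft_nbrs_center perm_refl.
by have [] := center_daisy nv Dv; have := center_order nv.
Qed.

Lemma candidate_displayed : S_maximal lam k Tg S T -> False.
Proof.
move=> [_ maxT]; have [[_ _ [X [kX uX ucX]] _] _] := minP.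
have le : tree_le lam k Tg S T T'.
  move=> Y kY dY; exists Y; last exact: (tequiv_refl lamP SP kY).
  by split=> //; apply: graft_displays.
have [Y [kY dY] tY] := maxT _ graft_partial_tree le X kX (graft_displays_uncrossed kX ucX).
by apply: uX; exists Y.
Qed.

End Flower.
End Refinement.

Theorem theorem7p1 (E : finType) (lam : {set E} -> int) (k : nat)
    (Tg S : {set {set E}}) (T : ptree E) :
  connectivity_system lam -> (0 < k)%N ->
  robust_tangle lam k Tg ->
  tree_compatible lam k Tg S ->
  S_maximal lam k Tg S T ->
  forall X : {set E}, kS_sep lam k S X ->
    exists Y : {set E},
      (kS_sep lam k S Y /\ tree_displays lam k T Y) /\ tequiv lam k Tg X Y.
Proof.
move=> lamP _ TgP SP maxT X kX; have [TP _] := maxT.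
have [[Y dY tY]|uX] := pselect (exists2 Y, tree_displays lam k T Y & tequiv lam k Tg X Y).
  by exists Y; split=> //; split=> //; apply: tequiv_kS tY.
exfalso.
have [_ [_ [_ [_ P5]]]] := TP.
have [sX [[Y [dY tY]]|[Y [b [bP [Yb tY]]]]]] := P5 X kX.
  by apply: uX; exists Y.
have kY := tequiv_kS SP kX tY.
have [X0 iX0] : exists X0, inner_kS lam k S (~: pt_bag T b) (undisplayed lam k Tg T) X0.
  have uY : undisplayed lam k Tg T Y.
    by case=> Z dZ tZ; apply: uX; exists Z => //; apply: tequiv_trans tY tZ.
  case: Yb => Yb; first by exists Y; split=> //; rewrite disjoints_subset setCK.
  exists (~: Y); split; first by rewrite (kSC k S lamP).
    by apply: undisplayed_tequiv uY; apply: (tequiv_compl lamP SP kY).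
  by rewrite disjoints_subset setCK.
pose a Z := `[< inner_kS lam k S (~: pt_bag T b) (undisplayed lam k Tg T) Z >].
have aX0 : a X0 by apply/asboolP.
case: (@arg_maxnP _ X0 a (fun Z => #|fcl lam k Tg Z|) aX0) => X1 /asboolP iX1 maxX1.
have [kX1 uX1 dX1] := iX1.
have aP : admissible lam k Tg S (~: pt_bag T b) (undisplayed lam k Tg T)
    #|fcl lam k Tg X1| [:: ~: X1; X1].
  split.
  - have := list_flower_pair lamP SP (_ : kS_sep lam k S (~: X1)).
    by rewrite setCK; apply; rewrite (kSC k S lamP).
  - by rewrite /= setCS; rewrite disjoints_subset setCK in dX1; rewrite dX1.
  - exists X1; split=> //; exists [:: ~: X1], [:: X1], [::]; split=> //.
    by left; rewrite bigcup_seq1_set.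
have [P minP] := exists_minimal_candidate lamP TgP SP (outside_big TP bP)
  (@undisplayed_tequiv E lam k Tg T) (fun Z iZ => maxX1 Z (asboolT iZ)) aP.
have [[fP /hasP[A AP NA] dP confP] sP] := minP.
(* The petal containing [N] is rotated to the front, where the old tree is attached. *)
have [n L eP] := rot_to AP.
apply: (@candidate_displayed _ _ _ _ _ _ b lamP TgP SP TP bP A L _ NA maxT).
rewrite -eP; apply: minimal_candidate_rot => //.
Qed.
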